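(* Let $K$ be an algebraically closed field of characteristic $0$ and let $C\subset\mathbb{P}^2$ be the Fermat curve $X^d+Y^d+Z^d=0$ over $K$ of degree $d\ge 4$. Then we have the following. (1) $\delta'[d]=3$. (2) If $d$ is even, then $\delta'[\ge 2]=\delta'[d]+\delta'[2]=3+3d$ and $\delta[\ge 2]=0$. (3) If $d$ is odd, then $\delta'[\ge 2]=\delta'[d]=3$ and $\delta[\ge 2]=\delta[2]=3d$.
   Context: For $P\in\mathbb{P}^2$, $\pi_P:C\dashrightarrow\mathbb{P}^1$ is the projection from $P$, and $G[P]=\{\tau\in\mathrm{Bir}(C)\mid \pi_P\circ\tau=\pi_P\}$. $P$ is called quasi-Galois if $|G[P]|\ge 2$. For an integer $n\ge 2$, $\delta[n]$ (resp. $\delta[\ge n]$) denotes the number of quasi-Galois points $P\in C$ with $|G[P]|=n$ (resp. $|G[P]|\ge n$), and $\delta'[n]$ (resp. $\delta'[\ge n]$) denotes the number of quasi-Galois points $P\in\mathbb{P}^2\setminus C$ with $|G[P]|=n$ (resp. $|G[P]|\ge n$). *)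

(* Defs.v *)
(* Mathematical Components, with multinomials and the classical sets of
   mathcomp-analysis. *)
From HB Require Import structures.
From mathcomp Require Import all_boot all_order all_algebra.
From mathcomp Require Export mpoly.
From mathcomp Require Import finmap boolp classical_sets functions cardinality.
From mathcomp Require Export constructive_ereal.

Set Implicit Arguments.
Unset Strict Implicit.
Unset Printing Implicit Defensive.

Import GRing.Theory.

Local Open Scope classical_set_scope.
Local Open Scope card_scope.
Local Open Scope ring_scope.

(* The number of elements of A as an extended natural number, so that no
   infinite set is ever counted by a junk natural number. *)
Definition card (T : choiceType) (A : set T) : \bar nat :=
  if pselect (finite_set A) then (#|` fset_set A|%N)%:E else +oo%E.

(* P^n(K): the lines through the origin of K^(n+1). *)
Definition proj_space (K : fieldType) (n : nat) : Type :=
  {V : {vspace 'rV[K]_n.+1} | \dim V == 1%N}.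
Definition line (K : fieldType) (n : nat) (P : proj_space K n) :
  {vspace 'rV[K]_n.+1} := sval P.

Section PlaneCurves.
Variable K : fieldType.

Definition zero_locus (f : {mpoly K[3]}) : set (proj_space K 2) :=
  [set P | forall v, v \in line P -> f.@[v 0] = 0].

Section RationalMaps.
(* In what follows C is an irreducible curve, given by its set of points. *)
Variable C : set (proj_space K 2).

Definition vanishes_on (f : {mpoly K[3]}) : Prop :=
  forall P, C P -> forall v, v \in line P -> f.@[v 0] = 0.

(* A representative (F_1 : ... : F_m) of a rational map from C to P^(m-1):
   forms of the same degree that do not all vanish identically on C. *)
Definition is_ratmap (m : nat) (F : m.-tuple {mpoly K[3]}) : Prop :=
  (exists e : nat, forall i, tnth F i \is e.-homog) /\
  (exists i, ~ vanishes_on (tnth F i)).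

(* Equality of the rational maps represented by F and G; it is an equivalence
   relation on representatives because C is irreducible. *)
Definition ratmap_eq (m : nat) (F G : m.-tuple {mpoly K[3]}) : Prop :=
  [/\ is_ratmap F, is_ratmap G &
      forall i j, vanishes_on (tnth F i * tnth G j - tnth F j * tnth G i)].

Definition ratmap_class (m : nat) (F : m.-tuple {mpoly K[3]}) :
    set (m.-tuple {mpoly K[3]}) :=
  [set G | ratmap_eq F G].

Definition ratmap_id : 3.-tuple {mpoly K[3]} := [tuple 'X_i | i < 3].

(* G after F.  It represents a rational map only if its components do not all
   vanish on C, which ratmap_eq requires wherever compositions are compared. *)
Definition ratmap_comp (m : nat) (G : m.-tuple {mpoly K[3]})
    (F : 3.-tuple {mpoly K[3]}) : m.-tuple {mpoly K[3]} :=
  [tuple tnth G i \mPo F | i < m].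

Definition ratmap_eval (m : nat) (F : m.-tuple {mpoly K[3]}) (v : 'rV[K]_3) :
    'rV[K]_m :=
  \row_i (tnth F i).@[v 0].

Definition maps_into_itself (F : 3.-tuple {mpoly K[3]}) : Prop :=
  forall P Q v, C P -> v \in line P -> ratmap_eval F v != 0 ->
    ratmap_eval F v \in line Q -> C Q.

Definition is_birational (F : 3.-tuple {mpoly K[3]}) : Prop :=
  [/\ is_ratmap F, maps_into_itself F &
      exists G, [/\ is_ratmap G, maps_into_itself G,
                    ratmap_eq (ratmap_comp G F) ratmap_id &
                    ratmap_eq (ratmap_comp F G) ratmap_id]].

(* Columns of A: a basis of the linear forms vanishing at P. *)
Definition is_projection_matrix (P : proj_space K 2) (A : 'M[K]_(3, 2)) : Prop :=
  \rank A = 2%N /\ forall v, v \in line P -> v *m A = 0.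

(* The projection from P is defined up to a projectivity of P^1, which does not
   affect whether it is preserved by a rational map; we choose a basis of the
   forms vanishing at P (one exists, see is_projection_matrix_ex). *)
Definition projection_matrix (P : proj_space K 2) : 'M[K]_(3, 2) :=
  xget 0 [set A | is_projection_matrix P A].

Definition projection (P : proj_space K 2) : 2.-tuple {mpoly K[3]} :=
  [tuple \sum_(i < 3) projection_matrix P i j *: 'X_i | j < 2].

(* The group G[P], as the set of its elements; a birational self-map is the
   equivalence class of its representatives. *)
Definition projection_group (P : proj_space K 2) :
    set (set (3.-tuple {mpoly K[3]})) :=
  [set tau | exists F, [/\ is_birational F, tau = ratmap_class F &
     ratmap_eq (ratmap_comp (projection P) F) (projection P)]].

Definition quasi_Galois (P : proj_space K 2) : Prop :=
  `I_2 #<= projection_group P.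

Definition delta_eq (n : nat) : \bar nat :=
  card [set P | [/\ C P, quasi_Galois P & projection_group P #= `I_n]].
Definition delta_ge (n : nat) : \bar nat :=
  card [set P | [/\ C P, quasi_Galois P & `I_n #<= projection_group P]].
Definition delta'_eq (n : nat) : \bar nat :=
  card [set P | [/\ ~ C P, quasi_Galois P & projection_group P #= `I_n]].
Definition delta'_ge (n : nat) : \bar nat :=
  card [set P | [/\ ~ C P, quasi_Galois P & `I_n #<= projection_group P]].

End RationalMaps.

Lemma is_projection_matrix_ex (P : proj_space K 2) :
  exists A, is_projection_matrix P A.
Proof.
case: P => V dV1; rewrite /is_projection_matrix /line /=.
have V0 : V != 0%VS by rewrite -dimv_eq0 (eqP dV1).
have v0 : vpick V != 0 by rewrite vpick0.
have VE : V = <[vpick V]>%VS.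
  apply/eqP; rewrite eq_sym eqEdim -memvE memv_pick (eqP dV1) dim_vline.
  by rewrite v0.
pose w := vpick V.
have rk : \rank (cokermx w) = 2%N by rewrite mxrank_coker rank_rV v0.
have wB : w *m col_base (cokermx w) = 0.
  apply: (row_free_inj (row_base_free (cokermx w))).
  by rewrite /= -mulmxA mulmx_base mulmx_coker mul0mx.
have rB : \rank (col_base (cokermx w)) = 2%N.
  by rewrite (eqnP (col_base_full _)) rk.
move: (col_base _) wB rB; rewrite rk => A wA rA; exists A; split=> // v.
by rewrite VE => /vlineP[k ->]; rewrite -scalemxAl wA scaler0.
Qed.

Definition fermat_curve (d : nat) : set (proj_space K 2) :=
  zero_locus (\sum_(i < 3) 'X_i ^+ d).

End PlaneCurves.
Arguments fermat_curve : clear implicits.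

(* Main.v *)
Require Import Defs.
From mathcomp Require Import all_boot all_order all_algebra.
From mathcomp Require Import finmap boolp classical_sets functions cardinality.
From mathcomp Require Import separable ring zify.

(* A rational self-map of C over the projection from p has the form
   v |-> a v + b p with Phi(a v + b p) = 0 on C, where Phi is the Fermat form.
   This is an equation for b / a over the homogeneous coordinate ring of C,
   which is normal.  If p is not on C, b / a is integral of degree 1,
   hence a linear form.  If p is on C, with tangent line T = 0, only T b / a is
   integral, of degree 2, hence a quadratic form q; comparing Phi(T v + q p)
   with Phi(v) along the lines through p forces T to divide q.  So every
   element of G[P] is a homology v |-> v + l(v) p preserving C.  Its mixed
   second derivatives show that it is a monomial matrix, hence either scales
   one coordinate (p is a coordinate point) or exchanges two of them
   (p = e_a + z e_b with z^d = (-1)^d). *)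

Set Implicit Arguments.
Unset Strict Implicit.
Unset Printing Implicit Defensive.

Import GRing.Theory.
Local Open Scope ring_scope.

(** * The affine curve x^d + 1 + z^d = 0 *)

(** Normality of C is obtained by hand from the d-sheeted cover (x, z) -> x: polynomials are reduced
    to degree below d in z, a fibre of d points then determines the values of the coefficients, and
    over the branch values x^d = -1 orders of vanishing are counted in powers of z. Integrality only
    removes denominators in an affine chart; the degree of a quotient is bounded by comparing two
    charts. For p on C every term of Phi(a v + b p) has a factor a, and what remains is an equation
    of degree d - 1 in b with leading coefficient d T. As T is not a unit, normality stops at T b =
    a q; that T divides q has to come from the geometry of the lines through p. Maps v |-> A v + B p
    that are constant on the lines through p have to be excluded separately, by the existence of a
    rational inverse. This accounts both for the condition 1 + l(p) != 0 and for an exceptional case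
    in the argument for p on C. *)

Section ClosedFieldPolynomials.
Variable K : closedFieldType.

Lemma poly_fun_eq0 (p : {poly K}) : (forall x, p.[x] = 0) -> p = 0.
Proof.
move=> p0; apply/eqP/negP => /negP /closed_nonrootP[x].
by rewrite /root p0 eqxx.
Qed.

Lemma dvd_coefs (p : {poly {poly K}}) (r : K) :
  (forall i, (p`_i).[r] = 0) ->
  exists2 q : {poly {poly K}},
    p = ('X - r%:P)%:P * q & (size q <= size p)%N.
Proof.
move=> pr; exists (\poly_(i < size p) (p`_i %/ ('X - r%:P))); last exact: size_poly.
apply/polyP => i; rewrite coefCM coef_poly.
case: ltnP => [_|/leq_sizeP->//]; last by rewrite mulr0.
by rewrite mulrC divpK // dvdp_XsubCl /root pr.
Qed.

Lemma exists_nth_roots (d : nat) (c : K) : d%:R != 0 :> K -> c != 0 ->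
  exists rs : seq K, [/\ uniq rs, size rs = d & forall z, (z \in rs) = (z ^+ d == c)].
Proof.
move=> d0 c0; have dp : (0 < d)%N by case: (d) d0; rewrite ?eqxx.
have sp : size ('X^d - c%:P : {poly K}) = d.+1 by rewrite size_XnsubC.
have mon : ('X^d - c%:P : {poly K}) \is monic by rewrite monicXnsubC.
have [rs E] := closed_field_poly_normal ('X^d - c%:P : {poly K}).
move: E; rewrite (monicP mon) scale1r => E; exists rs; split.
- rewrite -separable_prod_XsubC -E unlock.
  rewrite derivB derivXn derivC subr0 -scaler_nat coprimepZr //.
  case: (d) dp d0 => // n _ n0; rewrite /= coprimep_expr //.
  rewrite coprimepX /root hornerD hornerXn hornerN hornerC.
  by rewrite expr0n /= sub0r oppr_eq0.
- by move: sp; rewrite E size_prod_XsubC => -[].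
- move=> z; rewrite -root_prod_XsubC -E /root hornerD hornerXn hornerN hornerC.
  by rewrite subr_eq0.
Qed.

(* The inner variable of [{poly {poly K}}] is x, the outer one z. *)
Definition ev (x z : K) (p : {poly {poly K}}) : K := p.[z%:P].[x].

Lemma evD x z p q : ev x z (p + q) = ev x z p + ev x z q.
Proof. by rewrite /ev !hornerE. Qed.
Lemma evN x z p : ev x z (- p) = - ev x z p.
Proof. by rewrite /ev !hornerE. Qed.
Lemma evM x z p q : ev x z (p * q) = ev x z p * ev x z q.
Proof. by rewrite /ev !hornerE. Qed.
Lemma evC x z (n : {poly K}) : ev x z n%:P = n.[x].
Proof. by rewrite /ev !hornerE. Qed.
Lemma evX x z : ev x z 'X = z.
Proof. by rewrite /ev !hornerE. Qed.
Lemma evXn x z p n : ev x z (p ^+ n) = ev x z p ^+ n.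
Proof. by rewrite /ev !horner_exp. Qed.
Lemma ev0 x z : ev x z 0 = 0.
Proof. by rewrite /ev !hornerE. Qed.
Lemma ev1 x z : ev x z 1 = 1.
Proof. by rewrite /ev !hornerE. Qed.
Lemma ev_sum x z I (r : seq I) (P : pred I) (F : I -> {poly {poly K}}) :
  ev x z (\sum_(i <- r | P i) F i) = \sum_(i <- r | P i) ev x z (F i).
Proof. by rewrite /ev !horner_sum. Qed.

Definition evE := (ev0, ev1, evD, evN, evM, evXn, evC, evX).

Lemma ev_fiber x z p : ev x z p = (map_poly (horner_eval x) p).[z].
Proof.
by rewrite -[z in RHS](hornerC z x) -[z%:P.[x]]/(horner_eval x z%:P) horner_map.
Qed.

Lemma ev_coef x z (p : {poly {poly K}}) n : (size p <= n)%N ->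
  ev x z p = \sum_(i < n) (p`_i).[x] * z ^+ i.
Proof.
move=> sp; rewrite /ev (horner_coef_wide _ sp) horner_sum.
by apply: eq_bigr => i _; rewrite hornerM -rmorphXn /= hornerC.
Qed.

End ClosedFieldPolynomials.

Section AffineFermat.
Variables (K : closedFieldType) (d : nat).
Hypothesis d0 : d%:R != 0 :> K.

Let dp : (0 < d)%N. Proof. by case: (d) d0; rewrite ?eqxx. Qed.

Definition aff (x z : K) := x ^+ d + 1 + z ^+ d = 0.
Definition van0 (p : {poly {poly K}}) := forall x z, aff x z -> ev x z p = 0.

Let fermat1 : {poly {poly K}} := 'X^d + ('X^d + 1)%:P.

Let size_fermat1 : size fermat1 = d.+1.
Proof. by rewrite /fermat1 size_XnaddC. Qed.
Let monic_fermat1 : fermat1 \is monic.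
Proof. by rewrite /fermat1 monicXnaddC. Qed.

Lemma van0_fermat1 : van0 fermat1.
Proof.
move=> x z; rewrite /aff /fermat1 !evE hornerD hornerXn hornerC => <-.
by rewrite addrC.
Qed.

Lemma reduce_mod_fermat p : exists2 r : {poly {poly K}}, (size r <= d)%N &
  forall x z, aff x z -> ev x z p = ev x z r.
Proof.
exists (Pdiv.Ring.rmodp p fermat1).
  rewrite -ltnS -size_fermat1 Pdiv.Ring.ltn_rmodp.
  by rewrite -size_poly_eq0 size_fermat1.
move=> x z xz; rewrite [p in LHS](Pdiv.RingMonic.rdivp_eq monic_fermat1).
by rewrite evD evM (van0_fermat1 xz) mulr0 add0r.
Qed.

(** Off the branch values the fibre over x has d points, too many roots for a polynomial of degree
    below d in z. *)
Lemma fiber_coef_eq0 (p : {poly {poly K}}) x : (size p <= d)%N ->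
  x ^+ d + 1 != 0 -> (forall z, aff x z -> ev x z p = 0) -> forall i, (p`_i).[x] = 0.
Proof.
move=> sp nx px i; have nx' : - (x ^+ d + 1) != 0 by rewrite oppr_eq0.
have [rs [urs srs rsE]] := exists_nth_roots d0 nx'.
suff p0 : map_poly (horner_eval x) p = 0.
  by rewrite -[LHS]/(horner_eval x p`_i) -coef_map p0 coef0.
apply/eqP/negP => /negP p0.
have all_rs : all (root (map_poly (horner_eval x) p)) rs.
  apply/allP => z; rewrite rsE => /eqP zE; rewrite /root -ev_fiber px //.
  by rewrite /aff zE subrr.
have := max_poly_roots p0 all_rs urs; rewrite srs ltnNge.
by rewrite (leq_trans (size_poly _ _) sp).
Qed.

(** With [reduce_mod_fermat], this says that the coordinate ring of the chart is free over K[x] on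
    the powers of z below d. The factor x^d + 1 takes care of the branch values, where the fibre
    argument fails. *)
Lemma van0_reduced (p : {poly {poly K}}) : (size p <= d)%N -> van0 p -> p = 0.
Proof.
move=> sp p0; apply/polyP => i; rewrite coef0; apply/eqP.
have Nn0 : ('X^d + 1%:P : {poly K}) != 0.
  by rewrite -size_poly_eq0 size_XnaddC.
suff : p`_i * ('X^d + 1%:P) == 0 by rewrite mulf_eq0 (negPf Nn0) orbF.
apply/eqP/poly_fun_eq0 => x; rewrite hornerM hornerD hornerXn hornerC.
have [->|nx] := eqVneq (x ^+ d + 1) 0; first by rewrite mulr0.
by rewrite (fiber_coef_eq0 sp nx) ?mul0r // => z /p0.
Qed.

Lemma van0_cancel (n : {poly K}) p : n != 0 ->
  (forall x z, aff x z -> n.[x] * ev x z p = 0) -> van0 p.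
Proof.
move=> n0 np; have [r sr pr] := reduce_mod_fermat p.
have : n%:P * r = 0.
  apply: van0_reduced; last by move=> x z xz; rewrite !evE -pr // np.
  by rewrite (leq_trans (size_polyMleq _ _)) // size_polyC n0.
move/eqP; rewrite mulf_eq0 polyC_eq0 (negPf n0) /= => /eqP r0.
by move=> x z xz; rewrite pr // r0 ev0.
Qed.

Let XsubC_neq0 (r : K) : 'X - r%:P != 0 :> {poly K}.
Proof. by rewrite polyXsubC_eq0. Qed.

(* At the branch point (r, 0), z is a uniformizer and x - r is z^d up to a
   unit; i is the order of vanishing of f there. *)
Lemma order_at_branch_point (r : K) (f : {poly {poly K}}) : r ^+ d + 1 = 0 -> (size f <= d)%N ->
  ~ (forall i, (f`_i).[r] = 0) ->
  exists i, (i < d)%N /\ exists f' : {poly {poly K}},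
    (forall x z, aff x z -> ev x z f * z ^+ (d - i) = (x - r) * ev x z f') /\
    ev r 0 f' != 0.
Proof.
move=> rd sf /existsNP exi.
have {}exi : exists i, (f`_i).[r] != 0 by case: exi => i /eqP; exists i.
pose i := ex_minn exi.
have [fi imin] : (f`_i).[r] != 0 /\ forall j, (j < i)%N -> (f`_j).[r] = 0.
  rewrite /i; case: ex_minnP => k fk kmin; split=> // j jk.
  by apply/eqP/negP => /negP /kmin; rewrite leqNgt jk.
have id : (i < d)%N.
  rewrite ltnNge; apply: contraNN fi => di.
  by rewrite nth_default ?horner0 // (leq_trans sf).
exists i; split=> //.
have [g' g'E _] : exists2 q : {poly {poly K}}, take_poly i f = ('X - r%:P)%:P * q &
    (size q <= size (take_poly i f))%N.
  apply: dvd_coefs => j; rewrite coef_take_poly; case: ltnP => [/imin //|_].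
  by rewrite horner0.
have [N' NE] : exists N' : {poly K}, 'X^d + 1%:P = N' * ('X - r%:P).
  by apply/factor_theorem; rewrite /root hornerD hornerXn hornerC rd.
have N'r : N'.[r] != 0.
  have /(congr1 (fun p : {poly K} => p^`().[r])) := NE.
  rewrite derivD derivC addr0 derivXn derivM derivXsubC !hornerE.
  rewrite subrr mulr0 add0r /= hornerMn hornerXn => <-.
  rewrite -mulr_natl mulf_neq0 // expf_neq0 //.
  by apply: contra_eq_neq rd => ->; rewrite expr0n (gtn_eqF dp) add0r oner_eq0.
(* The part of f below z^i is (x - r) g', and z^(d-i) lifts the rest to a multiple of z^d = - N' (x
   - r). Since d - i > 0, the first term vanishes at (r, 0), leaving - N'(r) times the nonzero value
   of the coefficient of z^i. *)
exists ('X^(d - i) * g' - N'%:P * drop_poly i f); split; last first.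
  rewrite !evE expr0n subn_eq0 leqNgt id /= mul0r sub0r oppr_eq0.
  by rewrite mulf_neq0 // /ev polyC0 horner_coef0 coef_drop_poly add0n.
move=> x z xz.
have zd : z ^+ d = - N'.[x] * (x - r).
  have /(congr1 (fun p : {poly K} => p.[x])) := NE.
  rewrite hornerD hornerXn hornerC hornerM hornerXsubC mulNr => <-.
  by apply/eqP; rewrite -addr_eq0 addrC; apply/eqP.
rewrite -{1}(poly_take_drop i f) g'E !evE hornerXsubC.
rewrite mulrDl -(mulrA (ev x z (drop_poly i f))) -exprD subnKC ?(ltnW id) //.
by rewrite zd; ring.
Qed.

(* Irreducibility of the curve: orders of vanishing at a branch point add up. *)
Lemma van0_domain f g : van0 (f * g) -> van0 f \/ van0 g.
Proof.
have [r rd] : exists r : K, r ^+ d + 1 = 0.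
  have : size ('X^d + 1%:P : {poly K}) != 1 by rewrite size_XnaddC // eqSS -lt0n.
  case/closed_rootP => r; rewrite /root hornerD hornerXn hornerC => /eqP rd.
  by exists r.
(* [order_at_branch_point] needs a reduced polynomial whose coefficients do not all vanish at r. All
   factors x - r are therefore split off into n, by induction on the size of the leading
   coefficient. *)
have red h : ~ van0 h -> exists h' : {poly {poly K}}, exists n : {poly K},
    [/\ n != 0, (size h' <= d)%N, ~ (forall i, (h'`_i).[r] = 0) &
     forall x z, aff x z -> ev x z h = n.[x] * ev x z h'].
  move=> h0; have [h1 sh1 hh1] := reduce_mod_fermat h.
  have h1n0 : h1 != 0.
    by apply: contra_notN h0 => /eqP h10 x z xz; rewrite hh1 // h10 ev0.
  suff [h' [n [n0 sh' h'r E]]] : exists h' : {poly {poly K}}, exists n : {poly K},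
      [/\ n != 0, (size h' <= d)%N, ~ (forall i, (h'`_i).[r] = 0) & h1 = n%:P * h'].
    by exists h', n; split=> // x z xz; rewrite hh1 // E !evE.
  have [k] := ubnP (size (lead_coef h1)); elim: k h1 sh1 h1n0 {hh1} => // k IH h1 sh1 h1n0.
  rewrite ltnS => sk.
  have [h1r|h1r] := pselect (forall i, (h1`_i).[r] = 0); last first.
    by exists h1, 1; split; rewrite ?oner_eq0 // mul1r.
  have [q E sq] := dvd_coefs h1r.
  have q0 : q != 0 by apply: contra_neq h1n0 => q0; rewrite E q0 mulr0.
  have [|h' [n [n0 sh' h'r E']]] := IH q (leq_trans sq sh1) q0.
    apply: leq_trans sk; rewrite E lead_coefM lead_coefC mulrC.
    by rewrite size_Mmonic ?monicXsubC ?lead_coef_eq0 // size_XsubC addn2.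
  exists h', (('X - r%:P) * n); split=> //; first by rewrite mulf_neq0.
  by rewrite E E' polyCM mulrA.
move=> fg; have [|fn] := pselect (van0 f); first by left.
have [|gn] := pselect (van0 g); first by right.
exfalso.
have [f1 [nf [nf0 sf1 f1r fE]]] := red f fn.
have [g1 [ng [ng0 sg1 g1r gE]]] := red g gn.
have [i [id [f2 [f2E f2r]]]] := order_at_branch_point rd sf1 f1r.
have [j [jd [g2 [g2E g2r]]]] := order_at_branch_point rd sg1 g1r.
(* The product of the parts f2 and g2 is nonzero at (r, 0), yet it would vanish on the curve after
   cancelling a nonzero polynomial in x. *)
suff /(_ r 0) : van0 (f2 * g2).
  rewrite /aff rd expr0n (gtn_eqF dp) addr0 => /(_ erefl) /eqP.
  by rewrite evM mulf_eq0 (negPf f2r) (negPf g2r).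
have n0 : nf * ng * (('X - r%:P) * ('X - r%:P)) != 0 by rewrite !mulf_neq0.
apply: (van0_cancel n0) => x z xz; rewrite !hornerM hornerXsubC evM.
transitivity (ev x z (f * g) * (z ^+ (d - i) * z ^+ (d - j))).
  rewrite evM fE // gE //.
  transitivity (nf.[x] * ng.[x] * (((x - r) * ev x z f2) * ((x - r) * ev x z g2))).
    by ring.
  by rewrite -f2E // -g2E //; ring.
by rewrite fg // mul0r.
Qed.

(** This clears denominators: b / a becomes u b / n with n in K[x]. It is Bezout for a and the
    equation of the curve over the field of fractions of K[x]. A nonconstant gcd would split that
    equation up to a factor in K[x]; by irreducibility either the gcd vanishes on the curve, and a
    with it, or its cofactor does, although its degree in z is below d. *)
Lemma multiple_without_z a : ~ van0 a -> exists u : {poly {poly K}},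
  exists2 n : {poly K}, n != 0 & forall x z, aff x z -> ev x z u * ev x z a = n.[x].
Proof.
move=> an; have a0 : a != 0 by apply: contra_notN an => /eqP -> x z _; rewrite ev0.
have f0 : fermat1 != 0 by rewrite -size_poly_eq0 size_fermat1.
have [[u v] /Pdiv.Idomain.eqpP[[c1 c2] /= /andP[c10 c20] E]] :=
  Pdiv.Idomain.Bezoutp a fermat1.
set g := Pdiv.Idomain.gcdp a fermat1 in E.
have g0 : g != 0 by rewrite Pdiv.Idomain.gcdp_eq0 negb_and a0.
have [/eqP sg|sg] := eqVneq (size g) 1%N.
  have [e e0 ge] := size_poly1P _ sg.
  exists (c1%:P * u), (c2 * e); first by rewrite mulf_neq0.
  move=> x z xz; have /(congr1 (ev x z)) := E.
  rewrite -!mul_polyC ge !evM evD !evM (van0_fermat1 xz) mulr0 addr0 !evC hornerM => <-.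
  by rewrite mulrA.
exfalso.
have /Pdiv.Idomain.dvdpP[[c g'] /= c0 gE] := Pdiv.Idomain.dvdp_gcdr a fermat1.
have /Pdiv.Idomain.dvdpP[[e g''] /= e0 gE'] := Pdiv.Idomain.dvdp_gcdl a fermat1.
rewrite -/g in gE gE'.
have [gv|gv'] : van0 g \/ van0 g'.
  apply: van0_domain => x z xz; rewrite mulrC -gE -mul_polyC evM.
  by rewrite (van0_fermat1 xz) mulr0.
- apply: an; apply: (van0_cancel e0) => x z xz.
  by rewrite -(evC x z) -evM mul_polyC gE' evM gv // mulr0.
have g'0 : g' != 0.
  by apply: contra_neq f0 => g'0; move/eqP: gE;
     rewrite g'0 mul0r -mul_polyC mulf_eq0 polyC_eq0 (negPf c0) => /eqP.
case/negP: (g'0); apply/eqP/van0_reduced => //.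
have := congr1 (fun p : {poly {poly K}} => size p) gE.
rewrite /= size_scale // size_fermat1 size_mul // => sE.
have s1 : (1 < size g)%N by rewrite ltn_neqAle eq_sym sg lt0n size_poly_eq0.
by move: sE s1; case: (size g) => [|[|k]] //; rewrite !addnS /= => -[->] _; rewrite leq_addr.
Qed.

(* Normality of the affine curve: [g / n] is integral over its coordinate ring. *)
Lemma integral_dvd (n : {poly K}) (g : {poly {poly K}}) m
    (c : nat -> {poly {poly K}}) : n != 0 -> (size g <= d)%N ->
  (forall x z, aff x z -> ev x z g ^+ m +
     \sum_(j < m) ev x z (c j) * n.[x] ^+ j.+1 * ev x z g ^+ (m - j.+1) = 0) ->
  exists h : {poly {poly K}}, (size h <= d)%N /\ g = n%:P * h.
Proof.
have [k] := ubnP (size n); elim: k n g c => // k IH n g c; rewrite ltnS => sn n0 sg gE.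
have [/eqP sn1|sn1] := eqVneq (size n) 1%N.
  have [e e0 ne] := size_poly1P _ sn1.
  exists ((e^-1)%:P%:P * g); split; last first.
    by rewrite ne mulrA -!polyCM divff // mul1r.
  by rewrite (leq_trans _ sg) // mul_polyC size_scale ?polyC_eq0 ?invr_eq0.
have /closed_rootP[r] := sn1; case/factor_theorem => n' nE.
have n'0 : n' != 0 by apply: contra_neq n0 => n'0; rewrite nE n'0 mul0r.
have sn' : (size n' < k)%N.
  by move: sn; rewrite nE size_Mmonic ?monicXsubC // size_XsubC addn2.
have nr x : n.[x] = n'.[x] * (x - r) by rewrite nE hornerM hornerXsubC.
have g_pow x z : aff x z -> x = r -> ev x z g ^+ m = 0.
  move=> xz xr; move: (gE _ _ xz); rewrite big1 ?addr0 // => j _.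
  by rewrite nr xr subrr mulr0 expr0n mulr0 mul0r.
(* At a root r of n the equation reduces to g^m = 0. Over an unramified r the fibre then kills every
   coefficient of g at r; over a branch value the order of vanishing is needed. *)
have gr : forall i, (g`_i).[r] = 0.
  have [rd|rd] := eqVneq (r ^+ d + 1) 0; last first.
    apply: (fiber_coef_eq0 sg rd) => z xz; apply/eqP.
    by have /eqP := g_pow _ _ xz erefl; rewrite expf_eq0 => /andP[].
  apply: contrapT => gn.
  have [i [id [f [fE fr]]]] := order_at_branch_point rd sg gn.
  (* This is the equation times z^((d-i) m), divided by (x - r)^m. At (r, 0) all terms but f^m
     contain a positive power of z^(d-i), so f would vanish there. *)
  pose p := f ^+ m + \sum_(j < m) c j * n'%:P ^+ j.+1 * ('X^(d - i)) ^+ j.+1 *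
     f ^+ (m - j.+1).
  have pv : van0 p.
    have Xm0 : ('X - r%:P) ^+ m != 0 by rewrite expf_neq0.
    apply: (van0_cancel Xm0) => x z xz.
    have := congr1 (fun t => t * z ^+ (d - i) ^+ m) (gE _ _ xz).
    rewrite mul0r mulrDl -exprMn fE // => <-.
    rewrite /p evD mulrDr horner_exp hornerXsubC evXn -exprMn; congr (_ + _).
    rewrite ev_sum mulr_sumr mulr_suml; apply: eq_bigr => j _.
    have em (t : K) : t ^+ m = t ^+ j.+1 * t ^+ (m - j.+1) by rewrite -exprD subnKC.
    rewrite !em nr !evE.
    have := fE _ _ xz; move: (ev x z g) (ev x z f) (z ^+ (d - i)) => G F Z E.
    transitivity (ev x z (c j) * n'.[x] ^+ j.+1 * Z ^+ j.+1 * (x - r) ^+ j.+1 *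
      ((x - r) * F) ^+ (m - j.+1)); first by rewrite exprMn; ring.
    by rewrite -E !exprMn; ring.
  have := pv r 0; rewrite /aff rd expr0n (gtn_eqF dp) addr0 => /(_ erefl) /eqP.
  rewrite /p evD ev_sum big1 ?addr0; first by rewrite evXn expf_eq0 (negPf fr) andbF.
  move=> j _; rewrite !evE !expr0n subn_eq0 leqNgt id /= expr0n mulr0 mul0r //.
have [g' g'E sg'] := dvd_coefs gr.
have [|h [sh g'h]] := IH n' g' (fun j => c j) sn' n'0 (leq_trans sg' sg).
- have Xm0 : ('X - r%:P) ^+ m != 0 by rewrite expf_neq0.
  pose p := g' ^+ m + \sum_(j < m) c j * n'%:P ^+ j.+1 * g' ^+ (m - j.+1).
  have pv : van0 p.
    apply: (van0_cancel Xm0) => x z xz; have <- := gE _ _ xz.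
    rewrite /p evD mulrDr horner_exp hornerXsubC evXn g'E !evE -exprMn hornerXsubC.
    congr (_ + _); rewrite ev_sum mulr_sumr; apply: eq_bigr => j _.
    have em (t : K) : t ^+ m = t ^+ j.+1 * t ^+ (m - j.+1) by rewrite -exprD subnKC.
    rewrite !em nr !evE !exprMn; ring.
  move=> x z xz; transitivity (ev x z p); last exact: pv.
  rewrite /p evD evXn ev_sum; congr (_ + _).
  by apply: eq_bigr => j _; rewrite !evE.
exists h; split=> //; rewrite g'E g'h nE polyCM; ring.
Qed.

(** Multiplying the equation by u^m, with u a = n free of z, makes it an integral equation for u b
    over n, which [integral_dvd] handles. *)
Lemma integral_quotient (a b : {poly {poly K}}) m (c : nat -> {poly {poly K}}) :
  ~ van0 a ->
  (forall x z, aff x z -> ev x z b ^+ m +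
     \sum_(j < m) ev x z (c j) * ev x z a ^+ j.+1 * ev x z b ^+ (m - j.+1) = 0) ->
  exists h : {poly {poly K}}, (size h <= d)%N /\
    forall x z, aff x z -> ev x z b = ev x z a * ev x z h.
Proof.
move=> an bE; have [u [n n0 uE]] := multiple_without_z an.
have [g sg gE] := reduce_mod_fermat (u * b).
have [|h [sh gh]] := @integral_dvd n g m c n0 sg.
  move=> x z xz; rewrite -gE // evM exprMn.
  have := congr1 (fun t => ev x z u ^+ m * t) (bE _ _ xz); rewrite mulr0 => E.
  rewrite -[RHS]E mulrDr; congr (_ + _); rewrite mulr_sumr.
  apply: eq_bigr => j _; rewrite -(uE _ _ xz).
  have em (t : K) : t ^+ m = t ^+ j.+1 * t ^+ (m - j.+1) by rewrite -exprD subnKC.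
  by rewrite !em !exprMn; ring.
exists h; split=> // x z xz; apply/eqP; rewrite -subr_eq0; apply/eqP.
have -> : ev x z b - ev x z a * ev x z h = ev x z (b - a * h) by rewrite !evE.
move: x z xz; apply: (van0_cancel n0) => x z xz.
rewrite -(uE _ _ xz) !evE.
transitivity (ev x z a * (ev x z (u * b) - ev x z u * ev x z a * ev x z h)).
  by rewrite evM; ring.
by rewrite gE // gh uE // !evE subrr mulr0.
Qed.

End AffineFermat.

(** * Forms on the cone over the Fermat curve *)

Definition tri (R : nzRingType) (x y z : R) (i : 'I_3) : R := [:: x; y; z]`_i.

Lemma sum3 (V : nmodType) (F : 'I_3 -> V) : \sum_i F i = F 0 + F 1 + F 2%:R.
Proof.
rewrite !big_ord_recl big_ord0 addr0 addrA.
by congr (F _ + F _ + F _); apply: val_inj.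
Qed.

Lemma ord3P (P : 'I_3 -> Prop) : P 0 -> P 1 -> P 2%:R -> forall i, P i.
Proof.
move=> P0 P1 P2; case; case=> [|[|[|//]]] lti.
- by rewrite (_ : Ordinal lti = 0) //; apply: val_inj.
- by rewrite (_ : Ordinal lti = 1) //; apply: val_inj.
- by rewrite (_ : Ordinal lti = 2%:R) //; apply: val_inj.
Qed.

Lemma triE (R : nzRingType) (x y z : R) :
  ((tri x y z 0 = x) * (tri x y z 1 = y) * (tri x y z 2%:R = z))%type.
Proof. by []. Qed.

Section FermatCone.
Variables (K : closedFieldType) (d : nat).
Hypothesis d0 : d%:R != 0 :> K.
Implicit Types (f g : {mpoly K[3]}) (v : 'I_3 -> K).

Let dp : (0 < d)%N. Proof. by case: (d) d0; rewrite ?eqxx. Qed.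

Definition phi v : K := \sum_i v i ^+ d.
Definition van f := forall v, phi v = 0 -> f.@[v] = 0.
(** Homogeneity is required of the polynomial function only: this is immediate to check for
    compositions and for polynomials known through their values. *)
Definition form_of_degree e f := forall s v, f.@[fun i => s * v i] = s ^+ e * f.@[v].

Lemma form_of_degreeM e e' f g :
  form_of_degree e f -> form_of_degree e' g -> form_of_degree (e + e') (f * g).
Proof. by move=> fe ge s v; rewrite !mevalM fe ge exprD; ring. Qed.

Lemma form_of_degreeD e f g :
  form_of_degree e f -> form_of_degree e g -> form_of_degree e (f + g).
Proof. by move=> fe ge s v; rewrite !mevalD fe ge; ring. Qed.

Lemma form_of_degreeB e f g :
  form_of_degree e f -> form_of_degree e g -> form_of_degree e (f - g).
Proof. by move=> fe ge s v; rewrite !mevalB fe ge; ring. Qed.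

Lemma form_of_degreeZ e c f : form_of_degree e f -> form_of_degree e (c *: f).
Proof. by move=> fe s v; rewrite !mevalZ fe; ring. Qed.

Lemma form_of_degreeX i : form_of_degree 1 'X_i.
Proof. by move=> s v; rewrite !mevalXU expr1. Qed.

Lemma form_sum e I (r : seq I) (P : pred I) (F : I -> {mpoly K[3]}) :
  (forall i, form_of_degree e (F i)) -> form_of_degree e (\sum_(i <- r | P i) F i).
Proof.
by move=> Fe s v; rewrite !raddf_sum mulr_sumr; apply: eq_bigr => i _; apply: Fe.
Qed.

Lemma dhomog_form e f : f \is e.-homog -> form_of_degree e f.
Proof.
move=> /dhomogP fe s v; rewrite !mevalE mulr_sumr; apply: eq_big_seq => m /fe me.
rewrite mulrCA; congr (_ * _).
rewrite (_ : e = mdeg m) // mdegE -prodrXr -big_split /=.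
by apply: eq_bigr => i _; rewrite exprMn.
Qed.

Lemma phi_scale s v : phi (fun i => s * v i) = s ^+ d * phi v.
Proof. by rewrite /phi mulr_sumr; apply: eq_bigr => i _; rewrite exprMn. Qed.

Definition chart (h : 'I_3 -> {poly {poly K}}) f : {poly {poly K}} :=
  mmap (polyC \o polyC) h f.
Definition chart1 := chart (tri 'X%:P 1 'X).
Definition chart2 := chart (tri 1 'X%:P 'X).

Lemma ev_chart h f x z : ev x z (chart h f) = f.@[fun i => ev x z (h i)].
Proof.
rewrite mevalE /chart /mmap ev_sum; apply: eq_bigr => m _.
rewrite evM /= !evC hornerC; congr (_ * _).
rewrite /mmap1; elim/big_ind2: _ => [|a b a' b' <- <-|i _]; first exact: ev1.
  by rewrite evM.
by rewrite evXn.
Qed.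

Lemma ev_chart1 f x z : ev x z (chart1 f) = f.@[tri x 1 z].
Proof.
rewrite ev_chart; apply: meval_eq.
by apply: ord3P; rewrite !triE !evE ?hornerX.
Qed.

Lemma ev_chart2 f x z : ev x z (chart2 f) = f.@[tri 1 x z].
Proof.
rewrite ev_chart; apply: meval_eq.
by apply: ord3P; rewrite !triE !evE ?hornerX.
Qed.

Lemma aff_inv (x z : K) : x != 0 -> aff d x z -> aff d x^-1 (z / x).
Proof.
rewrite /aff => x0 xz; rewrite exprMn exprVn.
have xd0 : x ^+ d != 0 by rewrite expf_neq0.
apply: (mulfI xd0); rewrite mulr0 -xz !mulrDr mulr1 divff // mulrCA divff // mulr1.
by ring.
Qed.

Lemma form_chart e f (x z : K) : form_of_degree e f -> x != 0 ->
  f.@[tri x 1 z] = x ^+ e * f.@[tri 1 x^-1 (z / x)].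
Proof.
move=> fe x0; rewrite -fe; apply: meval_eq; apply: ord3P; rewrite !triE ?mulr1 //.
  by rewrite divff.
by rewrite mulrCA divff // mulr1.
Qed.

(** The charts are exchanged by (x, z) |-> (1/x, z/x); the points with x = 0 are recovered by
    cancelling the factor x. *)
Lemma van0_chart12 e f : form_of_degree e f -> van0 d (chart1 f) <-> van0 d (chart2 f).
Proof.
move=> fe; split=> fv.
  apply: (van0_cancel d0 (n := 'X)); first by rewrite polyX_eq0.
  move=> x z xz; rewrite hornerX; have [->|x0] := eqVneq x 0; first by rewrite mul0r.
  have := fv _ _ (aff_inv x0 xz); rewrite ev_chart1 (form_chart _ fe) ?invr_eq0 //.
  rewrite invrK mulfVK // => /eqP; rewrite mulf_eq0 expf_eq0 invr_eq0 (negPf x0) andbF.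
  by rewrite ev_chart2 => /eqP ->; rewrite mulr0.
apply: (van0_cancel d0 (n := 'X)); first by rewrite polyX_eq0.
move=> x z xz; rewrite hornerX; have [->|x0] := eqVneq x 0; first by rewrite mul0r.
have := fv _ _ (aff_inv x0 xz); rewrite ev_chart2 ev_chart1 (form_chart _ fe) //.
by move=> ->; rewrite !mulr0.
Qed.

Lemma phi_chart1 (x z : K) : phi (tri x 1 z) = x ^+ d + 1 + z ^+ d.
Proof. by rewrite /phi sum3 !triE expr1n. Qed.

Lemma phi_chart2 (x z : K) : phi (tri 1 x z) = x ^+ d + 1 + z ^+ d.
Proof. by rewrite /phi sum3 !triE expr1n (addrC 1). Qed.

Lemma cone_point : exists u, phi u = 0 /\ u 0 = 1.
Proof.
have [|[|z rs] [_ srs rsE]] := exists_nth_roots d0 (c := -1).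
- by rewrite oppr_eq0 oner_eq0.
- by move: dp; rewrite -srs.
exists (tri 1 0 z); split; last by [].
rewrite phi_chart2 expr0n (gtn_eqF dp) add0r.
by have := rsE z; rewrite mem_head => /esym/eqP ->; rewrite subrr.
Qed.

Lemma van_chart1 e f : form_of_degree e f -> van f <-> van0 d (chart1 f).
Proof.
move=> fe; split=> fv.
  by move=> x z xz; rewrite ev_chart1 fv // phi_chart1.
have fv2 : van0 d (chart2 f) by apply/(van0_chart12 fe).
move=> v vC; have [v1|v1] := eqVneq (v 1) 0; last first.
  have -> : f.@[v] = f.@[fun i => v 1 * tri (v 0 / v 1) 1 (v 2%:R / v 1) i].
    by apply: meval_eq; apply: ord3P; rewrite !triE ?mulr1 // mulrCA divff ?mulr1.
  rewrite fe -ev_chart1 fv ?mulr0 // /aff -phi_chart1.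
  apply: (mulfI (expf_neq0 d v1)); rewrite -phi_scale mulr0 -vC; apply: eq_bigr => i _.
  congr (_ ^+ _); move: i.
  by apply: ord3P; rewrite !triE ?mulr1 // mulrCA divff ?mulr1.
have [v00|v00] := eqVneq (v 0) 0; last first.
  have -> : f.@[v] = f.@[fun i => v 0 * tri 1 (v 1 / v 0) (v 2%:R / v 0) i].
    by apply: meval_eq; apply: ord3P; rewrite !triE ?mulr1 // mulrCA divff ?mulr1.
  rewrite fe -ev_chart2 fv2 ?mulr0 // /aff -phi_chart2.
  apply: (mulfI (expf_neq0 d v00)); rewrite -phi_scale mulr0 -vC; apply: eq_bigr => i _.
  congr (_ ^+ _); move: i.
  by apply: ord3P; rewrite !triE ?mulr1 // mulrCA divff ?mulr1.
(* The only point of the cone outside both charts is the origin, where f takes the value 0^e f(u)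
   for any u; choosing u on the cone also covers e = 0. *)
have v2 : v 2%:R = 0.
  apply/eqP; move/eqP: vC; rewrite /phi sum3 v1 v00 !expr0n (gtn_eqF dp) !add0r.
  by rewrite expf_eq0 => /andP[].
have [u [uC u0]] := cone_point.
have -> : f.@[v] = f.@[fun i => 0 * u i].
  by apply: meval_eq; apply: ord3P; rewrite mul0r.
have -> : f.@[fun i => 0 * u i] = 0 ^+ e * f.@[tri 1 (u 1) (u 2%:R)].
  by rewrite fe; congr (_ * _); apply: meval_eq; apply: ord3P; rewrite !triE.
rewrite -ev_chart2 fv2 ?mulr0 // /aff -phi_chart2 -[RHS]uC.
by apply: eq_bigr => i _; congr (_ ^+ _); move: i; apply: ord3P; rewrite !triE.
Qed.

Lemma van_domain e e' f g : form_of_degree e f -> form_of_degree e' g -> van (f * g) -> van f \/ van g.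
Proof.
move=> fe ge fg; rewrite (van_chart1 fe) (van_chart1 ge); apply: van0_domain => //.
by move=> x z xz; rewrite evM !ev_chart1 -mevalM fg // phi_chart1.
Qed.

(* The quotient is a polynomial in both charts (x, 1, z) and (1, x, z), which
   bounds its degree. *)
Lemma form_quotient e w (a b : {mpoly K[3]}) m (c : nat -> {mpoly K[3]}) :
  form_of_degree e a -> form_of_degree (e + w) b -> ~ van a ->
  (forall v, phi v = 0 -> b.@[v] ^+ m +
     \sum_(j < m) (c j).@[v] * a.@[v] ^+ j.+1 * b.@[v] ^+ (m - j.+1) = 0) ->
  exists h : nat -> nat -> K, forall v, phi v = 0 -> b.@[v] = a.@[v] *
    \sum_(i < w.+1) \sum_(j < w.+1 - i) h i j *
      (v 0 ^+ j * v 1 ^+ (w - i - j) * v 2%:R ^+ i).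
Proof.
move=> ae be an bE.
have a1n : ~ van0 d (chart1 a) by rewrite -(van_chart1 ae).
have a2n : ~ van0 d (chart2 a) by rewrite -(van0_chart12 ae).
have [|h1 [sh1 h1E]] := integral_quotient d0 (b := chart1 b) (m := m)
  (c := fun j => chart1 (c j)) a1n.
  move=> x z xz; rewrite -[RHS](bE (tri x 1 z)) ?phi_chart1 // !ev_chart1.
  by congr (_ + _); apply: eq_bigr => j _; rewrite ev_chart1.
have [|h2 [sh2 h2E]] := integral_quotient d0 (b := chart2 b) (m := m)
  (c := fun j => chart2 (c j)) a2n.
  move=> x z xz; rewrite -[RHS](bE (tri 1 x z)) ?phi_chart2 // !ev_chart2.
  by congr (_ + _); apply: eq_bigr => j _; rewrite ev_chart2.
pose D := (\max_(i < d) size (h2`_i)%R)%N.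
have sD i : (size (h2`_i)%R <= D)%N.
  have [id|di] := ltnP i d; first exact: (leq_bigmax (Ordinal id)).
  by rewrite (nth_default _ (leq_trans sh2 di)) size_poly0.
(* Reversed coefficients: x^D h2(1/x, z/x) without its denominators in z, so that h2 can be compared
   with h1 as polynomials. *)
pose R i : {poly K} := \poly_(k < D.+1) (h2`_i)`_(D - k).
have RE i x : x != 0 -> (R i).[x] = x ^+ D * (h2`_i).[x^-1].
  move=> x0; rewrite /R horner_poly (horner_coef_wide _ (leqW (sD i))) mulr_sumr.
  rewrite (reindex_inj rev_ord_inj) /=; apply: eq_bigr => k _.
  have kD : (k <= D)%N by rewrite -ltnS.
  rewrite subSS subKn // mulrCA; congr (_ * _).
  by rewrite exprVn; apply: (mulIf (expf_neq0 k x0)); rewrite mulfVK ?expf_neq0 // -exprD subnK.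
(* The difference h1(x, z) - x^w h2(1/x, z/x) of the two expressions for b / a, times x^(D+d). The
   surplus x^d keeps the exponents w + d - i nonnegative for i < d. *)
pose f : {poly {poly K}} :=
  ('X^(D + d))%:P * h1 - \poly_(i < d) ('X^(w + d - i) * R i).
have sf : (size f <= d)%N.
  rewrite (leq_trans (size_polyD _ _)) // geq_max size_polyN size_poly andbT.
  by rewrite size_Cmul // -size_poly_eq0 size_polyXn.
have fx x z : x != 0 -> ev x z f =
    x ^+ (D + d) * (ev x z h1 - x ^+ w * ev x^-1 (z / x) h2).
  move=> x0; rewrite /f evD evN evM evC hornerXn mulrBr; congr (_ - _).
  rewrite (ev_coef _ _ (size_poly _ _)) (ev_coef _ _ sh2) !mulr_sumr.
  apply: eq_bigr => i _; rewrite coef_poly ltn_ord hornerM hornerXn RE //.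
  have -> : (w + d - i = w + (d - i))%N by rewrite addnBA // ltnW.
  have xd : x ^+ d = x ^+ (d - i) * x ^+ i by rewrite -exprD subnK // ltnW.
  rewrite !exprD xd exprMn exprVn; have xi : x ^+ i != 0 by rewrite expf_neq0.
  by field.
have f0 : f = 0.
  apply: (van0_reduced d0 sf).
  have n0 : ('X : {poly K}) != 0 by rewrite polyX_eq0.
  have af : van0 d (chart1 a * f).
    apply: (van0_cancel d0 n0) => x z xz; rewrite hornerX.
    have [->|x0] := eqVneq x 0; first by rewrite mul0r.
    rewrite evM fx // ev_chart1.
    have := h2E _ _ (aff_inv x0 xz); rewrite !ev_chart2 => E2.
    have := h1E _ _ xz; rewrite !ev_chart1 !(form_chart _ be) // !(form_chart _ ae) //.
    rewrite E2 => E1.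
    transitivity (x * x ^+ (D + d) * (x ^+ e * a.@[tri 1 x^-1 (z / x)] * ev x z h1 -
       x ^+ (e + w) * (a.@[tri 1 x^-1 (z / x)] * ev x^-1 (z / x) h2))).
      by rewrite !exprD; ring.
    by rewrite E1 subrr mulr0.
  by case: (van0_domain d0 af).
(* Since R i has degree at most D, comparing the coefficients of z^i in f = 0 bounds the degree of
   that of h1 by w - i; h1 therefore homogenizes to the form H of degree w. *)
have sh1w i : (size (h1`_i)%R <= w.+1 - i)%N.
  have [di|id] := leqP d i; first by rewrite (nth_default _ (leq_trans sh1 di)) size_poly0.
  have /(congr1 (fun p : {poly {poly K}} => p`_i)) := f0.
  rewrite coef0 coefB coefCM coef_poly id => /eqP; rewrite subr_eq0 => /eqP E.
  have [->|hi0] := eqVneq h1`_i 0; first by rewrite size_poly0.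
  have : (size (h1`_i)%R + (D + d) <= w + d - i + D.+1)%N.
    have := congr1 (fun p : {poly K} => size p) E.
    rewrite /= mulrC size_mulXn // addnC => ->.
    have [->|Ri0] := eqVneq (R i) 0; first by rewrite mulr0 size_poly0.
    by rewrite mulrC size_mulXn // leq_add2l size_poly.
  move: (size _) id => s; lia.
exists (fun i j => (h1`_i)`_j) => v vC.
pose H : {mpoly K[3]} := \sum_(i < w.+1) \sum_(j < w.+1 - i) (h1`_i)`_j *:
  ('X_0 ^+ j * 'X_1 ^+ (w - i - j) * 'X_(2%:R) ^+ i).
have HE u : H.@[u] = \sum_(i < w.+1) \sum_(j < w.+1 - i) (h1`_i)`_j *
      (u 0 ^+ j * u 1 ^+ (w - i - j) * u 2%:R ^+ i).
  rewrite /H raddf_sum /=; apply: eq_bigr => i _; rewrite raddf_sum /=; apply: eq_bigr => j _.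
  by rewrite mevalZ !mevalM !rmorphXn /= !mevalXU.
rewrite -HE; apply/eqP; rewrite -subr_eq0 -mevalM -mevalB; apply/eqP.
have He : form_of_degree w H.
  move=> s u; rewrite !HE mulr_sumr; apply: eq_bigr => i _; rewrite mulr_sumr.
  apply: eq_bigr => j _; rewrite !exprMn.
  have sw : s ^+ w = s ^+ j * s ^+ (w - i - j) * s ^+ i.
    rewrite -!exprD; congr (_ ^+ _).
    by have := ltn_ord i; have := ltn_ord j; lia.
  by rewrite sw; ring.
have Re : form_of_degree (e + w) (b - a * H) by apply: form_of_degreeB => //; apply: form_of_degreeM.
move: v vC; apply/(van_chart1 Re) => x z xz.
rewrite ev_chart1 mevalB mevalM HE.
have := h1E _ _ xz; rewrite !ev_chart1 => ->; apply/eqP; rewrite subr_eq0; apply/eqP.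
have sw : (size h1 <= w.+1)%N.
  apply/leq_sizeP => i wi; apply/eqP; rewrite -size_poly_leq0 (leq_trans (sh1w i)) //.
  by rewrite leqn0 subn_eq0.
congr (_ * _); rewrite (ev_coef _ _ sw); apply: eq_bigr => i _.
rewrite (horner_coef_wide _ (sh1w i)) mulr_suml; apply: eq_bigr => j _.
by rewrite !triE expr1n mulr1 mulrA.
Qed.

End FermatCone.

(** * The ideal of the cone is generated by the Fermat form *)

Section ConeIdeal.
Variables (K : closedFieldType) (d : nat).
Hypothesis d0 : d%:R != 0 :> K.
Implicit Types (f g : {mpoly K[3]}) (v : 'I_3 -> K).
Local Notation phi := (phi d).
Local Notation van := (van d).

Let dp : (0 < d)%N. Proof. by case: (d) d0; rewrite ?eqxx. Qed.

Definition Phi : {mpoly K[3]} := \sum_(i < 3) 'X_i ^+ d.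

Lemma Phi_eval v : Phi.@[v] = phi v.
Proof.
rewrite /Phi raddf_sum /=; apply: eq_bigr => i _.
by rewrite rmorphXn /= mevalXU.
Qed.

Lemma ev_fun_eq0 (p : {poly {poly K}}) : (forall x z, ev x z p = 0) -> p = 0.
Proof.
move=> p0; apply/polyP => i; rewrite coef0; apply: poly_fun_eq0 => x.
rewrite -[LHS]/(horner_eval x p`_i) -coef_map.
have -> : map_poly (horner_eval x) p = 0.
  by apply: poly_fun_eq0 => z; rewrite -ev_fiber.
by rewrite coef0.
Qed.

(** Iterated polynomials, with z outermost, give access to Euclidean division by the Fermat form,
    which is monic in z. *)
Let P3 := {poly {poly {poly K}}}.
Let ev3 x y z (p : P3) := ev x y p.[z%:P%:P].

Let to3 (f : {mpoly K[3]}) : P3 :=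
  mmap (polyC \o (polyC \o polyC)) (tri 'X%:P%:P 'X%:P 'X) f.

Let eval_at (R S : comNzRingType) (g : {rmorphism R -> S}) (u : S) :
  {rmorphism {poly R} -> S} := horner_morph (fun a => mulrC u (g a)).

Let eval_atC (R S : comNzRingType) (g : {rmorphism R -> S}) u a : eval_at g u a%:P = g a.
Proof. exact: horner_morphC. Qed.

Let eval_atX (R S : comNzRingType) (g : {rmorphism R -> S}) u : eval_at g u 'X = u.
Proof. exact: horner_morphX. Qed.

Let of3 : {rmorphism P3 -> {mpoly K[3]}} :=
  eval_at (eval_at (eval_at (@mpolyC 3 K) 'X_0) 'X_1) 'X_(2%:R).

Let of3C c : of3 c%:P%:P%:P = c%:MP.
Proof. by rewrite /of3 !eval_atC. Qed.

Let of3_tri i : of3 (tri 'X%:P%:P 'X%:P 'X i) = 'X_i.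
Proof. by move: i; apply: ord3P; rewrite !triE /of3 ?eval_atC ?eval_atX. Qed.

Let to3K f : of3 (to3 f) = f.
Proof.
rewrite [RHS]mpolyE /to3 /mmap rmorph_sum; apply: eq_bigr => m _.
rewrite rmorphM /= of3C -mul_mpolyC; congr (_ * _).
rewrite [RHS]mpolyXE_id /mmap1 rmorph_prod; apply: eq_bigr => i _.
by rewrite rmorphXn of3_tri.
Qed.

Let ev3_to3 f x y z : ev3 x y z (to3 f) = f.@[tri x y z].
Proof.
rewrite mevalE /to3 /mmap /ev3 horner_sum ev_sum; apply: eq_bigr => m _.
rewrite hornerM evM /= !hornerC evC hornerC; congr (_ * _).
rewrite /mmap1; elim/big_ind2: _ => [|a b a' b' <- <-|i _]; first by rewrite hornerC ev1.
  by rewrite hornerM evM.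
rewrite horner_exp evXn; congr (_ ^+ _); move: i.
by apply: ord3P; rewrite !triE ?hornerC ?hornerX ?evE ?hornerX ?hornerC.
Qed.

(** The remainder of the division in z has degree below d, and for x^d + y^d != 0 it vanishes at d
    values of z; so its coefficients times x^d + y^d are zero. *)
Lemma van_dvd f : van f -> exists g, f = Phi * g.
Proof.
move=> fv; pose N : {poly {poly K}} := 'X^d + ('X^d)%:P.
have sN : size N = d.+1 by rewrite size_XnaddC.
have NE x y : ev x y N = x ^+ d + y ^+ d by rewrite /N !evE hornerXn addrC.
pose F : P3 := 'X^d + N%:P.
have sF : size F = d.+1 by rewrite size_XnaddC.
have Fm : F \is monic by rewrite monicXnaddC.
have FE x y z : ev3 x y z F = phi (tri x y z).
  rewrite /ev3 /F hornerD hornerXn hornerC evD NE evXn evC hornerC.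
  by rewrite /phi sum3 !triE addrC.
have toF : of3 F = Phi.
  rewrite /F rmorphD /= rmorphXn /N polyCD rmorphD /= !rmorphXn /=.
  have := of3_tri 0; have := of3_tri 1; have := of3_tri 2%:R.
  by rewrite !triE => -> -> ->; rewrite /Phi sum3 addrC (addrC ('X_1 ^+ d)).
have fE := Pdiv.RingMonic.rdivp_eq Fm (to3 f).
set q := Pdiv.CommonRing.rdivp _ _ in fE; set r := Pdiv.CommonRing.rmodp _ _ in fE.
suff r0 : r = 0.
  by exists (of3 q); rewrite -[LHS]to3K fE r0 addr0 rmorphM toF mulrC.
have sr : (size r <= d)%N.
  by rewrite -ltnS -sF Pdiv.Ring.ltn_rmodp -size_poly_eq0 sF.
apply/polyP => i; rewrite coef0; apply/eqP.
have N0 : N != 0 by rewrite -size_poly_eq0 sN.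
suff : r`_i * N == 0 by rewrite mulf_eq0 (negPf N0) orbF.
apply/eqP/ev_fun_eq0 => x y; rewrite evM NE.
have [->|xy] := eqVneq (x ^+ d + y ^+ d) 0; first by rewrite mulr0.
have [rs [urs srs rsE]] : exists rs : seq K,
    [/\ uniq rs, size rs = d & forall z, (z \in rs) = (z ^+ d == - (x ^+ d + y ^+ d))].
  by apply: exists_nth_roots; rewrite ?oppr_eq0.
pose e (p : {poly {poly K}}) := ev x y p.
pose rxy : {poly K} := \poly_(j < d) ev x y r`_j.
have rxyE z : ev3 x y z r = rxy.[z].
  rewrite /ev3 (horner_coef_wide _ sr) ev_sum horner_poly; apply: eq_bigr => j _.
  by rewrite evM -!rmorphXn /= !evE hornerC.
suff rxy0 : rxy = 0.
  have [id|di] := ltnP i d; last by rewrite nth_default ?(leq_trans sr) // ev0 mul0r.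
  have := coef0 K i; rewrite -rxy0 coef_poly id => ->; by rewrite mul0r.
apply/eqP/negP => /negP rn0.
have all_rs : all (root rxy) rs.
  apply/allP => z; rewrite rsE => /eqP zE.
  have C : phi (tri x y z) = 0 by rewrite /phi sum3 !triE zE subrr.
  have := fv _ C; rewrite -ev3_to3 fE /ev3 hornerD hornerM evD evM -/(ev3 x y z F).
  by rewrite FE C mulr0 add0r -/(ev3 x y z r) rxyE /root => ->.
have := max_poly_roots rn0 all_rs urs.
by rewrite srs ltnNge size_poly.
Qed.

Lemma mpoly_fun_eq0 f : (forall v, f.@[v] = 0) -> f = 0.
Proof.
move=> f0; rewrite -(to3K f) (_ : to3 f = 0) ?rmorph0 //.
apply/polyP => i; rewrite coef0; apply: ev_fun_eq0 => x y.
pose n := size (to3 f).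
have [ni|ni] := leqP n i; first by rewrite nth_default // ev0.
pose rxy : {poly K} := \poly_(j < n) ev x y (to3 f)`_j.
suff rxy0 : rxy = 0 by have := coef0 K i; rewrite -rxy0 coef_poly ni.
apply: poly_fun_eq0 => z; rewrite -[RHS](f0 (tri x y z)) -ev3_to3.
rewrite horner_poly /ev3 horner_coef ev_sum; apply: eq_bigr => j _.
by rewrite evM -!rmorphXn /= !evE hornerC.
Qed.

(** Zariski density of g != 0. It lets an identity be divided by values of T and then be evaluated
    on T = 0. *)
Lemma mpoly_fun_dense f g h : g != 0 ->
  (forall v, g.@[v] != 0 -> f.@[v] = h.@[v]) -> forall v, f.@[v] = h.@[v].
Proof.
move=> g0 fh; have : g * (f - h) = 0.
  apply: mpoly_fun_eq0 => v; rewrite mevalM mevalB.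
  by have [->|gv] := eqVneq g.@[v] 0; rewrite ?mul0r // fh // subrr mulr0.
move/eqP; rewrite mulf_eq0 (negPf g0) subr_eq0 => /eqP -> //.
Qed.

End ConeIdeal.

(** * Lines through a point *)

Section LinesThroughPoint.
Variables (K : closedFieldType) (d : nat).
Hypothesis d0 : d%:R != 0 :> K.
Implicit Types (f g : {mpoly K[3]}) (v : 'I_3 -> K).
Local Notation phi := (phi d).
Local Notation van := (van d).
Local Notation Phi := (Phi K d).

Let dp : (0 < d)%N. Proof. by case: (d) d0; rewrite ?eqxx. Qed.

Definition lform (l : 'I_3 -> K) : {mpoly K[3]} := \sum_i l i *: 'X_i.

Lemma lform_eval l v : (lform l).@[v] = \sum_i l i * v i.
Proof.
by rewrite /lform raddf_sum /=; apply: eq_bigr => i _; rewrite mevalZ mevalXU.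
Qed.

Lemma form_lform l : form_of_degree 1 (lform l).
Proof. by apply: form_sum => i; apply: form_of_degreeZ; apply: form_of_degreeX. Qed.

Lemma exists_ord3_neq (i : 'I_3) : exists j : 'I_3, j != i.
Proof.
by move: i; apply: ord3P; [exists 1|exists 0|exists 0].
Qed.

Hypothesis d4 : (4 <= d)%N.

(** The points e_j + z e_i with z^d = -1 lie on C, and two different values of z already force the
    coefficient l i to be zero. *)
Lemma van_lform l : van (lform l) -> forall i, l i = 0.
Proof.
move=> lv i; have [j ji] := exists_ord3_neq i.
have [|rs [urs srs rsE]] := exists_nth_roots d0 (c := -1).
  by rewrite oppr_eq0 oner_eq0.
have lz z : z \in rs -> l j + l i * z = 0.
  rewrite rsE => /eqP zd.
  pose v k := if k == i then z else (k == j)%:R : K.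
  have other (F : 'I_3 -> K) : (forall k, k != i -> k != j -> F k = 0) ->
      \sum_k F k = F j + F i.
    move=> F0; rewrite (bigD1 j) //= (bigD1 i) 1?eq_sym //= big1 ?addr0 // => k.
    by case/andP=> kj ki; apply: F0.
  have <- : (lform l).@[v] = l j + l i * z.
    rewrite lform_eval other; first by rewrite /v eqxx (negPf ji) eqxx mulr1.
    by move=> k ki kj; rewrite /v (negPf ki) (negPf kj) mulr0.
  apply: lv; rewrite /phi other; last first.
    by move=> k ki kj; rewrite /v (negPf ki) (negPf kj) expr0n (gtn_eqF dp).
  by rewrite /v eqxx (negPf ji) eqxx expr1n zd subrr.
case: rs urs srs lz {rsE} => [|z1 [|z2 rs]]; try by move=> _ sd; move: d4; rewrite -sd.
rewrite /= inE negb_or => /andP[/andP[z12 _] _] _ lz.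
have /eqP : l i * (z1 - z2) = 0.
  have E1 := lz z1 (mem_head _ _).
  have E2 : l j + l i * z2 = 0 by apply: lz; rewrite !inE eqxx orbT.
  transitivity ((l j + l i * z1) - (l j + l i * z2)); first by ring.
  by rewrite E1 E2 subrr.
by rewrite mulf_eq0 subr_eq0 (negPf z12) orbF => /eqP.
Qed.

Definition line_poly v p : {mpoly K[3]} -> {poly K} :=
  mmap polyC (fun i => (v i)%:P + (p i)%:P * 'X).

Lemma line_polyE v p f t : (line_poly v p f).[t] = f.@[fun i => v i + t * p i].
Proof.
rewrite mevalE /line_poly /mmap horner_sum; apply: eq_bigr => m _.
rewrite hornerM hornerC; congr (_ * _); rewrite /mmap1 horner_prod.
apply: eq_bigr => i _; rewrite horner_exp hornerD hornerM !hornerC hornerX.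
by rewrite (mulrC t).
Qed.

Lemma line_polyM v p f g : line_poly v p (f * g) = line_poly v p f * line_poly v p g.
Proof. by rewrite /line_poly rmorphM. Qed.

(* Up to a binomial coefficient, the coefficient of x^k y^(d-k) in
   phi (x v + y p). *)
Definition polar (p : 'I_3 -> K) k : {mpoly K[3]} := \sum_i p i ^+ (d - k) *: 'X_i ^+ k.

Lemma polar_eval p k v : (polar p k).@[v] = \sum_i p i ^+ (d - k) * v i ^+ k.
Proof.
rewrite /polar raddf_sum /=; apply: eq_bigr => i _.
by rewrite mevalZ rmorphXn /= mevalXU.
Qed.

Lemma form_polar p k : form_of_degree k (polar p k).
Proof.
apply: form_sum => i; apply: form_of_degreeZ => s v.
by rewrite !rmorphXn /= !mevalXU exprMn.
Qed.

Lemma phi_expand p v (x y : K) :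
  phi (fun i => x * v i + y * p i) =
  \sum_(k < d.+1) 'C(d, k)%:R * x ^+ k * y ^+ (d - k) * (polar p k).@[v].
Proof.
under [RHS]eq_bigr => k _ do rewrite polar_eval mulr_sumr.
rewrite exchange_big /=; apply: eq_bigr => i _; rewrite addrC exprDn.
by apply: eq_bigr => k _; rewrite !exprMn -mulr_natl; ring.
Qed.

Lemma line_phiE v p : line_poly v p Phi =
  \poly_(k < d.+1) ('C(d, k)%:R * (polar p (d - k)).@[v]).
Proof.
apply/eqP; rewrite -subr_eq0; apply/eqP/poly_fun_eq0 => t.
rewrite hornerD hornerN line_polyE Phi_eval horner_poly.
have -> : phi (fun i => v i + t * p i) = phi (fun i => 1 * v i + t * p i).
  by apply: eq_bigr => i _; rewrite mul1r.
rewrite phi_expand (reindex_inj rev_ord_inj) /= -sumrB big1 // => i _.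
rewrite subSS bin_sub -1?ltnS // subKn -1?ltnS // expr1n; ring.
Qed.

Lemma coef_line_phi v p k : (k <= d)%N ->
  (line_poly v p Phi)`_k = 'C(d, k)%:R * (polar p (d - k)).@[v].
Proof. by move=> kd; rewrite line_phiE coef_poly ltnS kd. Qed.

Lemma polar0 p v : (polar p 0).@[v] = phi p.
Proof. by rewrite polar_eval; apply: eq_bigr => i _; rewrite subn0 mulr1. Qed.

Lemma polard p v : (polar p d).@[v] = phi v.
Proof. by rewrite polar_eval; apply: eq_bigr => i _; rewrite subnn mul1r. Qed.

Lemma polar_self p k : (k <= d)%N -> (polar p k).@[p] = phi p.
Proof. by move=> kd; rewrite polar_eval; apply: eq_bigr => i _; rewrite -exprD subnK. Qed.

Hypothesis char0 : forall n : nat, (n%:R == 0 :> K) = (n == 0)%N.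

(** Smoothness in coordinates: if a and b were nonzero, the first two equations would make (p, q)
    proportional to (a, b), so that p^d + q^d = 0 and then r = 0. *)
Let two_coordinates (a b p q r : K) : r != 0 -> a ^+ d + b ^+ d = 0 ->
  a ^+ d.-1 * p + b ^+ d.-1 * q = 0 -> p ^+ d + q ^+ d + r ^+ d = 0 -> a = 0 /\ b = 0.
Proof.
move=> r0 ab pq pqr.
have dE : d = d.-1.+1 by rewrite prednK.
have zero (s t : K) : s ^+ d + t ^+ d = 0 -> s = 0 -> t = 0.
  move=> st s0; move: st; rewrite s0 expr0n (gtn_eqF dp) add0r => /eqP.
  by rewrite expf_eq0 => /andP[_ /eqP].
have [a0|a0] := eqVneq a 0; first by split=> //; apply: zero ab a0.
have b0 : b != 0.
  by apply: contra_neq a0 => b0; rewrite (zero b a) // addrC.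
exfalso; have E : q * a = p * b.
  apply: (mulfI (expf_neq0 d.-1 b0)).
  have {}pq : b ^+ d.-1 * q = - (a ^+ d.-1 * p).
    by apply/eqP; rewrite -addr_eq0 addrC; apply/eqP.
  rewrite mulrA pq mulrCA [b ^+ d.-1 * b]mulrC -exprS -dE.
  have -> : b ^+ d = - a ^+ d by apply/eqP; rewrite -addr_eq0 addrC; apply/eqP.
  by rewrite [in RHS]dE exprS; ring.
case/negP: r0; suff : p ^+ d + q ^+ d = 0.
  by move=> pq0; move/eqP: pqr; rewrite pq0 add0r expf_eq0 => /andP[].
apply: (mulfI (expf_neq0 d a0)).
rewrite mulrDr mulr0 -!exprMn (mulrC a q) E !exprMn.
by rewrite -[RHS](mulr0 (p ^+ d)) -[in RHS]ab; ring.
Qed.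

Let no_line_aux (p u : 'I_3 -> K) i0 : p i0 != 0 -> u i0 = 0 ->
  (forall t, phi (fun i => u i + t * p i) = 0) -> forall i, u i = 0.
Proof.
move=> pi0 ui0 up.
have lu0 : line_poly u p Phi = 0.
  by apply: poly_fun_eq0 => t; rewrite line_polyE Phi_eval.
have cf j : (j <= d)%N -> \sum_i p i ^+ j * u i ^+ (d - j) = 0.
  move=> jd; have := coef_line_phi u p jd; rewrite lu0 coef0 polar_eval => /esym/eqP.
  by rewrite mulf_eq0 char0 gtn_eqF ?bin_gt0 //= subKn // => /eqP.
(* The coefficients of t^0, t^1 and t^d suffice: u is on the cone, p is in the tangent space at u,
   and p is on the cone. *)
have := cf 0 isT; have := cf 1 dp; have := cf d (leqnn d).
rewrite !sum3 subnn subn0 subn1 !expr0 !expr1 !mulr1 !mul1r {cf lu0 up}.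
have z0 : (0 : K) ^+ d = 0 by rewrite expr0n (gtn_eqF dp).
have z1 : (0 : K) ^+ d.-1 = 0 by rewrite expr0n; case: (d) d4 => [|[|]].
move: i0 pi0 ui0; apply: ord3P => r0 u0; rewrite u0 z0 z1 mulr0 ?add0r ?addr0 => E1 E2 E3.
- have [||? ?] := two_coordinates r0 E3 (p := p 1) (q := p 2%:R).
  + by rewrite -[RHS]E2; ring.
  + by rewrite -[RHS]E1; ring.
  by apply: ord3P.
- have [||? ?] := two_coordinates r0 E3 (p := p 0) (q := p 2%:R).
  + by rewrite -[RHS]E2; ring.
  + by rewrite -[RHS]E1; ring.
  by apply: ord3P.
- have [||? ?] := two_coordinates r0 E3 (p := p 0) (q := p 1).
  + by rewrite -[RHS]E2; ring.
  + by rewrite -[RHS]E1; ring.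
  by apply: ord3P.
Qed.

(** C contains no line. Moving u along p to reach u i0 = 0 reduces the claim to two coordinates. *)
Lemma no_line (p u : 'I_3 -> K) i0 : p i0 != 0 ->
  (forall t, phi (fun i => u i + t * p i) = 0) -> exists k, forall i, u i = k * p i.
Proof.
move=> pi0 up; exists (u i0 / p i0) => i; apply/eqP; rewrite -subr_eq0; apply/eqP.
apply: (no_line_aux (u := fun j => u j - u i0 / p i0 * p j) pi0).
  by rewrite mulfVK // subrr.
move=> t; rewrite -[RHS](up (t - u i0 / p i0)).
by apply: eq_bigr => j _; congr (_ ^+ _); ring.
Qed.

End LinesThroughPoint.

(** * Maps constant on the lines through a point *)

Section Collapse.
Variables (K : closedFieldType) (d : nat).
Hypothesis d0 : d%:R != 0 :> K.
Hypothesis d4 : (4 <= d)%N.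
Hypothesis char0 : forall n : nat, (n%:R == 0 :> K) = (n == 0)%N.
Implicit Types (f g : {mpoly K[3]}) (v : 'I_3 -> K).
Local Notation phi := (phi d).
Local Notation van := (van d).
Local Notation Phi := (Phi K d).
Local Notation polar := (polar d).

Let dp : (0 < d)%N. Proof. by case: (d) d0; rewrite ?eqxx. Qed.

Section Pencil.
Variables (p : 'I_3 -> K) (i0 : 'I_3).
Hypothesis pi0 : p i0 != 0.

Definition shift (A B : {mpoly K[3]}) : 3.-tuple {mpoly K[3]} :=
  [tuple A * 'X_i + p i *: B | i < 3].

Lemma shift_eval A B f v :
  (f \mPo shift A B).@[v] = f.@[fun i => A.@[v] * v i + B.@[v] * p i].
Proof.
rewrite comp_mpoly_meval; apply: meval_eq => i.
by rewrite tnth_mktuple mevalD mevalM mevalXU mevalZ (mulrC (p i)).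
Qed.

Lemma form_shift e n A B f : form_of_degree e A -> form_of_degree e.+1 B ->
  form_of_degree n f -> form_of_degree (e.+1 * n) (f \mPo shift A B).
Proof.
move=> Ae Be fn s v; rewrite !shift_eval exprM -fn; apply: meval_eq => i.
by rewrite Ae Be exprS; ring.
Qed.

Let T := polar p 1.

Lemma polar1_neq0 : T != 0.
Proof.
apply/eqP => /(congr1 (meval (fun i => (i == i0)%:R))).
rewrite meval0 polar_eval (bigD1 i0) //= eqxx big1 ?addr0.
  by rewrite mulr1 => /eqP; rewrite expf_eq0 (negPf pi0) andbF.
by move=> i /negPf ->; rewrite mulr0.
Qed.

Lemma polar1_nvan : ~ van T.
Proof.
have -> : T = lform (fun i => p i ^+ (d - 1)) by [].
by move/(van_lform d0 d4)/(_ i0)/eqP; rewrite expf_eq0 (negPf pi0) andbF.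
Qed.

Lemma form_polar1 : form_of_degree 1 T.
Proof. exact: form_polar. Qed.

(** The coefficient of t^(d-1) in Phi(v + t p) is d T(v). *)
Lemma size_line_phi v : T.@[v] != 0 -> (d <= size (line_poly v p Phi))%N.
Proof.
move=> Tv; rewrite leqNgt; apply: contra_neqN Tv => sz.
have d1 : (d.-1 <= d)%N by exact: leq_pred.
have := coef_line_phi v p d1; rewrite nth_default; last by rewrite -ltnS prednK.
have -> : (d - d.-1 = 1)%N by rewrite -{1}(prednK dp) subSnn.
move/esym/eqP; rewrite mulf_eq0 char0 => /orP[|/eqP //].
by rewrite gtn_eqF // bin_gt0.
Qed.

(* N is constant on the lines through p, so G (N v) can only be proportional to
   all points of such a line by being zero. *)
Lemma no_collapse A B e n (G : 'I_3 -> {mpoly K[3]}) :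
  form_of_degree e A -> form_of_degree e.+1 B -> (forall i, form_of_degree n (G i)) ->
  (forall v t, A.@[fun i => v i + t * p i] = A.@[v]) ->
  (forall v t, B.@[fun i => v i + t * p i] = B.@[v] - t * A.@[v]) ->
  let N v i := A.@[v] * v i + B.@[v] * p i in
  (forall v, phi v = 0 -> forall i j, (G i).@[N v] * v j = (G j).@[N v] * v i) ->
  forall v, phi v = 0 -> forall i, (G i).@[N v] = 0.
Proof.
move=> Ae Be Gn At Bt N GN v vC i; rewrite -shift_eval; move: v vC.
pose H i := G i \mPo shift A B.
have HE j v : (H j).@[v] = (G j).@[N v] by rewrite shift_eval.
have He j : form_of_degree (e.+1 * n) (H j) by apply: form_shift.
have Ht j v t : (H j).@[fun i => v i + t * p i] = (H j).@[v].
  by rewrite !HE; apply: meval_eq => k; rewrite /N At Bt; ring.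
(* The 2 x 2 minor W of (H, v) vanishes on C, hence is a multiple of Phi. As H is constant along v +
   t p, W has degree at most 1 in t, whereas Phi has degree at least d - 1 there. So W vanishes on
   the whole line, and both of its coefficients in t give a relation. *)
have key v : T.@[v] != 0 -> forall j k,
    (H j).@[v] * v k = (H k).@[v] * v j /\ (H j).@[v] * p k = (H k).@[v] * p j.
  move=> Tv j k; pose W := H j * 'X_k - H k * 'X_j.
  have Wv : van W.
    move=> u uC; rewrite mevalB !mevalM !mevalXU !HE.
    by apply/eqP; rewrite subr_eq0 GN.
  have [g WE] := van_dvd d0 Wv.
  pose c1 := (H j).@[v] * p k - (H k).@[v] * p j.
  have lW : line_poly v p W = (W.@[v])%:P + c1%:P * 'X.
    apply/eqP; rewrite -subr_eq0; apply/eqP/poly_fun_eq0 => t.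
    rewrite hornerD hornerN line_polyE hornerD hornerM !hornerC hornerX.
    by rewrite !mevalB !mevalM !mevalXU !Ht /c1; ring.
  have lW0 : line_poly v p W = 0.
    apply/eqP/negP => /negP lWn0; have := lW; rewrite WE line_polyM => lE.
    have sW : (size (line_poly v p W) <= 2)%N.
      rewrite lW (leq_trans (size_polyD _ _)) // geq_max (leq_trans (size_polyC_leq1 _)) //.
      by rewrite (leq_trans (size_polyMleq _ _)) // size_polyX addn2 /= ltnS size_polyC_leq1.
    move: sW lWn0; rewrite WE line_polyM mulf_eq0 negb_or => + /andP[l1 l2].
    rewrite size_mul //; have := size_line_phi Tv; move: l2; rewrite -size_poly_gt0.
    by move: (size _) (size _) => s1 s2; lia.
  have E0 : W.@[v] = 0 by have := congr1 (fun q : {poly K} => q`_0) lW;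
    rewrite lW0 coef0 coefD coefC coefMX eqxx addr0 => <-.
  have E1 : c1 = 0 by have := congr1 (fun q : {poly K} => q`_1) lW;
    rewrite lW0 coef0 coefD coefC coefMX coefC eqxx add0r => <-.
  split; apply/eqP; rewrite -subr_eq0; last by apply/eqP.
  by move: E0; rewrite mevalB !mevalM !mevalXU => ->.
have [j ji] := exists_ord3_neq i0.
(* H is now proportional both to v and to p. L measures the independence of v and p in the
   coordinates i0 and j, so H L = 0 where T is nonzero; irreducibility removes L and T. *)
pose L : {mpoly K[3]} := lform (fun k => p i0 * (k == j)%:R - p j * (k == i0)%:R).
have LE v : L.@[v] = p i0 * v j - p j * v i0.
  rewrite lform_eval (bigD1 j) //= (bigD1 i0) 1?eq_sym //= big1 => [|k /andP[/negPf kj /negPf ki]].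
    by rewrite !eqxx (eq_sym i0) (negPf ji) /= !mulr1 !mulr0; ring.
  by rewrite kj ki /= !mulr0; ring.
have Ln : ~ van L.
  move/(van_lform d0 d4)/(_ j); rewrite eqxx (negPf ji) mulr0 subr0 mulr1 => /eqP.
  by rewrite (negPf pi0).
have : van ((H i * L) * T).
  move=> v vC; rewrite !mevalM LE.
  have [->|Tv] := eqVneq T.@[v] 0; first by rewrite mulr0.
  have [a1 b1] := key v Tv i j; have [a2 b2] := key v Tv i i0; have [a3 b3] := key v Tv j i0.
  suff -> : (H i).@[v] * (p i0 * v j - p j * v i0) = 0 by rewrite mul0r.
  transitivity ((H i).@[v] * v j * p i0 - (H i).@[v] * v i0 * p j); first by ring.
  rewrite a1 a2; transitivity (v i * ((H j).@[v] * p i0 - (H i0).@[v] * p j)); first by ring.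
  by rewrite b3 subrr mulr0.
case/(van_domain d0 (form_of_degreeM (He i) (form_lform _)) form_polar1) => [|/polar1_nvan //].
by case/(van_domain d0 (He i) (form_lform _)).
Qed.

End Pencil.

End Collapse.

(** * The quotient b / a is a linear form *)

Section LinearQuotient.
Variables (K : closedFieldType) (d : nat).
Hypothesis d0 : d%:R != 0 :> K.
Hypothesis d4 : (4 <= d)%N.
Hypothesis char0 : forall n : nat, (n%:R == 0 :> K) = (n == 0)%N.
Implicit Types (f g : {mpoly K[3]}) (v : 'I_3 -> K).
Local Notation phi := (phi d).
Local Notation van := (van d).
Local Notation Phi := (Phi K d).
Local Notation polar := (polar d).

Let dp : (0 < d)%N. Proof. by case: (d) d0; rewrite ?eqxx. Qed.

Section Centre.
Variables (p : 'I_3 -> K) (i0 : 'I_3).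
Hypothesis pi0 : p i0 != 0.
Local Notation shift := (shift p).
Let T := polar p 1.

Lemma van_cancelX e e' a f n : form_of_degree e a -> form_of_degree e' f -> ~ van a ->
  van (a ^+ n * f) -> van f.
Proof.
move=> ae fe an; elim: n => [|n IH]; first by rewrite expr0 mul1r.
rewrite exprS -mulrA => av; apply: IH.
have aen m : form_of_degree (m * e) (a ^+ m).
  by move=> s v; rewrite !rmorphXn /= ae exprMn mulnC exprM.
by case: (van_domain d0 ae (form_of_degreeM (aen n) fe) av).
Qed.


Section Quotient.
Variables (e : nat) (a b : {mpoly K[3]}).
Hypotheses (ae : form_of_degree e a) (be : form_of_degree e.+1 b) (an : ~ van a).
Hypothesis abC : forall v, phi v = 0 -> phi (fun i => a.@[v] * v i + b.@[v] * p i) = 0.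
Variables (n : nat) (G : 'I_3 -> {mpoly K[3]}).
Hypothesis Gn : forall i, form_of_degree n (G i).
Hypothesis GF : forall v, phi v = 0 -> forall i j,
  (G i \mPo shift a b).@[v] * v j = (G j \mPo shift a b).@[v] * v i.
Variable i1 : 'I_3.
Hypothesis Gi1 : ~ van (G i1 \mPo shift a b).

Let shift_prop A B f m v : form_of_degree m f -> A.@[v] * b.@[v] = a.@[v] * B.@[v] ->
  a.@[v] ^+ m * (f \mPo shift A B).@[v] = A.@[v] ^+ m * (f \mPo shift a b).@[v].
Proof.
move=> fm AB; rewrite !shift_eval -!fm; apply: meval_eq => i.
by rewrite !mulrDr !mulrA AB; ring.
Qed.

(* Here (A : B) = (a : b) on the curve, and the map v |-> A v + B p factors
   through the projection, so it is not invertible. *)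
Lemma collapse_contra A B e' : form_of_degree e' A -> form_of_degree e'.+1 B ->
  (forall v t, A.@[fun i => v i + t * p i] = A.@[v]) ->
  (forall v t, B.@[fun i => v i + t * p i] = B.@[v] - t * A.@[v]) ->
  ~ van A -> (forall v, phi v = 0 -> A.@[v] * b.@[v] = a.@[v] * B.@[v]) -> False.
Proof.
move=> Ae Be At Bt An AB; apply: Gi1.
have Hab i := form_shift p ae be (Gn i).
have HAB i := form_shift p Ae Be (Gn i).
apply: (van_cancelX (n := n) Ae (Hab i1) An) => v vC.
rewrite mevalM rmorphXn /= -(shift_prop (Gn i1) (AB v vC)) shift_eval.
rewrite (no_collapse d0 d4 char0 pi0 Ae Be Gn At Bt) ?mulr0 //.
move=> u uC i j; rewrite -!shift_eval.
have : van ((G i \mPo shift A B) * 'X_j - (G j \mPo shift A B) * 'X_i).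
  have W := form_of_degreeB (form_of_degreeM (HAB i) (@form_of_degreeX K j))
     (form_of_degreeM (HAB j) (@form_of_degreeX K i)).
  apply: (van_cancelX (n := n) ae W an) => w wC.
  rewrite mevalM mevalB !mevalM !mevalXU rmorphXn /= mulrBr !mulrA.
  by rewrite !shift_prop ?AB // -!mulrA GF // subrr.
move=> /(_ u uC); rewrite mevalB !mevalM !mevalXU => /eqP.
by rewrite subr_eq0 => /eqP.
Qed.

(** If l(p) = -1, then v |-> v + l(v) p is the linear projection along p onto the kernel of l: the
    case A = 1, B = l of [collapse_contra]. *)
Lemma linear_quotient_unit (l : 'I_3 -> K) :
  (forall v, phi v = 0 -> b.@[v] = a.@[v] * \sum_i l i * v i) ->
  1 + \sum_i l i * p i != 0.
Proof.
move=> bE; apply/eqP => lp.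
have one : form_of_degree 0 (1 : {mpoly K[3]}) by move=> s v; rewrite !meval1 mulr1.
apply: (@collapse_contra 1 (lform l) 0 one (form_lform l)).
- by move=> v t; rewrite !meval1.
- move=> v t; rewrite !lform_eval meval1.
  have {}lp : \sum_i l i * p i = - 1 by apply/eqP; rewrite -addr_eq0 addrC lp.
  rewrite mulr1 -[X in _ - X]mulr1 -mulrN -lp mulr_sumr -big_split /=.
  by apply: eq_bigr => i _; ring.
- have [u [uC _]] := cone_point d0; move=> /(_ u uC) /eqP.
  by rewrite meval1 oner_eq0.
- by move=> v vC; rewrite meval1 mul1r lform_eval bE.
Qed.

(** In the expansion of phi (a v + b p) the coefficient of b^d is phi p, a nonzero constant, so
    division by it gives an integral equation for b / a. *)
Lemma linear_quotient_off_curve : phi p != 0 ->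
  exists l : 'I_3 -> K, forall v, phi v = 0 -> b.@[v] = a.@[v] * \sum_i l i * v i.
Proof.
move=> pC.
pose c j := ('C(d, j.+1)%:R / phi p) *: polar p j.+1.
have be1 : form_of_degree (e + 1) b by rewrite addn1.
have [|h hE] := form_quotient d0 (m := d) (c := c) ae be1 an.
  move=> v vC; apply: (mulfI pC); rewrite mulr0.
  have := abC vC; rewrite (phi_expand d p) big_ord_recl => E.
  rewrite -[RHS]E mulrDr; congr (_ + _).
    by rewrite polar0 bin0 expr0 subn0; ring.
  rewrite mulr_sumr; apply: eq_bigr => j _.
  by rewrite /c mevalZ /= /bump leq0n add1n; field.
exists (tri (h 0%N 1%N) (h 0%N 0%N) (h 1%N 0%N)) => v vC; rewrite hE //; congr (_ * _).
rewrite sum3 !triE !big_ord_recl !big_ord0 /= /bump /= !addn0 !expr0 !expr1; ring.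
Qed.

Section OnCurve.
Hypothesis pC : phi p = 0.

Let D := d.-2.
Let dD : d = D.+2. Proof. by rewrite /D; case: (d) d4 => [|[|]]. Qed.
Let c j := ('C(d, j.+2)%:R / d%:R) *: (polar p j.+2 * T ^+ j).

(* [E] is [phi (a v + b p) / a] on the curve. *)
Let E : {mpoly K[3]} := \sum_(k < D.+2) 'C(d, k.+1)%:R *: (a ^+ k * b ^+ (D.+1 - k) * polar p k.+1).

Let formX f m k : form_of_degree m f -> form_of_degree (m * k) (f ^+ k).
Proof. by move=> fm s v; rewrite !rmorphXn /= fm exprMn exprM. Qed.

Let form_eq m m' f : form_of_degree m f -> m = m' -> form_of_degree m' f.
Proof. by move=> ? <-. Qed.

Let E_form : form_of_degree (e.+1 * D.+1 + 1) E.
Proof.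
apply: form_sum => k; apply: form_of_degreeZ.
apply: (form_eq (form_of_degreeM (form_of_degreeM (formX k ae) (formX _ be))
  (form_polar d p k.+1))).
have := ltn_ord k; rewrite ltnS => kD.
by have := subnKC kD; move: (D.+1 - k)%N (nat_of_ord k) => s k' <-; nia.
Qed.

Let c_eval j v : (c j).@[v] = 'C(d, j.+2)%:R / d%:R * ((polar p j.+2).@[v] * T.@[v] ^+ j).
Proof. by rewrite mevalZ mevalM rmorphXn. Qed.

(** Multiplied by T^D / d, the equation E = 0 becomes monic in T b, with the coefficients [c j]. The
    second witness B is the symmetric bilinear form of q, read off from its coefficients. *)
Lemma quadratic_quotient :
  exists q : {mpoly K[3]}, exists B : ('I_3 -> K) -> 'I_3 -> K,
  [/\ form_of_degree 2 q,
      forall u v s, q.@[fun i => u i + s * v i] =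
        q.@[u] + s * (\sum_i B v i * u i) + s ^+ 2 * q.@[v],
      forall v, phi v = 0 -> T.@[v] * b.@[v] = a.@[v] * q.@[v] &
      q.@[p] = 0].
Proof.
have EC : van E.
  have : van (a ^+ 1 * E).
    move=> v vC; rewrite expr1 mevalM -(abC vC) (phi_expand d p).
    rewrite -(big_mkord xpredT (fun k => 'C(d, k)%:R * a.@[v] ^+ k * b.@[v] ^+ (d - k) *
      (polar p k).@[v])) big_nat_recl // polar0 pC mulr0 add0r big_mkord.
    rewrite raddf_sum /= mulr_sumr dD; apply: eq_bigr => k _.
    by rewrite mevalZ !mevalM !rmorphXn /= exprS subSS; ring.
  exact: van_cancelX ae E_form an.
have be2 : form_of_degree (e + 2) (T * b).
  by apply: (form_eq (form_of_degreeM (form_polar d p 1) be)); lia.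
have [|h hE] := form_quotient d0 (m := D.+1) (c := c) ae be2 an.
  move=> v vC; have := EC v vC; rewrite raddf_sum /= big_ord_recl => Ev.
  apply: (mulfI d0); rewrite mulr0 -[RHS](mulr0 (T.@[v] ^+ D)) -[in RHS]Ev !mulrDr.
  congr (_ + _).
    by rewrite mevalZ !mevalM !rmorphXn /= bin1 expr0 subn0 exprMn [T.@[v] ^+ D.+1]exprS; ring.
  rewrite !mulr_sumr; apply: eq_bigr => j _; rewrite mevalZ !mevalM !rmorphXn /=.
  rewrite c_eval exprMn /bump leq0n add1n subSS.
  have -> : T.@[v] ^+ D = T.@[v] ^+ j * T.@[v] ^+ (D - j).
    by rewrite -exprD subnKC // -ltnS.
  by field.
pose q : {mpoly K[3]} := h 0%N 0%N *: ('X_1 * 'X_1) + h 0%N 1%N *: ('X_0 * 'X_1) +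
  h 0%N 2%N *: ('X_0 * 'X_0) + h 1%N 0%N *: ('X_1 * 'X_(2%:R)) +
  h 1%N 1%N *: ('X_0 * 'X_(2%:R)) + h 2%N 0%N *: ('X_(2%:R) * 'X_(2%:R)).
have qE v : q.@[v] = h 0%N 0%N * (v 1 * v 1) + h 0%N 1%N * (v 0 * v 1) +
  h 0%N 2%N * (v 0 * v 0) + h 1%N 0%N * (v 1 * v 2%:R) +
  h 1%N 1%N * (v 0 * v 2%:R) + h 2%N 0%N * (v 2%:R * v 2%:R).
  by rewrite !mevalD !mevalZ !mevalM !mevalXU.
have q2 : form_of_degree 2 q by move=> s v; rewrite !qE; ring.
have bq v : phi v = 0 -> T.@[v] * b.@[v] = a.@[v] * q.@[v].
  move=> vC; rewrite -mevalM hE // qE; congr (_ * _).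
  rewrite !big_ord_recl !big_ord0 /= /bump /= !addn0 !expr0 !expr1; ring.
(* The equation is divided by a^(D+1) because it will be used at p, where a may vanish. *)
have qC v : phi v = 0 -> q.@[v] ^+ D.+1 +
    \sum_(j < D.+1) (c j).@[v] * q.@[v] ^+ (D.+1 - j.+1) = 0.
  pose Q : {mpoly K[3]} := q ^+ D.+1 + \sum_(j < D.+1) c j * q ^+ (D.+1 - j.+1).
  have Q2 : form_of_degree (2 * D.+1) Q.
    apply: form_of_degreeD; first exact: formX.
    apply: form_sum => j.
    apply: (form_eq (form_of_degreeM (form_of_degreeZ _ (form_of_degreeM
      (form_polar d p j.+2) (formX j (form_polar d p 1)))) (formX _ q2))).
    by have := ltn_ord j; rewrite subSS; lia.
  have QE u : Q.@[u] = q.@[u] ^+ D.+1 +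
      \sum_(j < D.+1) (c j).@[u] * q.@[u] ^+ (D.+1 - j.+1).
    rewrite mevalD rmorphXn raddf_sum /=; congr (_ + _); apply: eq_bigr => j _.
    by rewrite mevalM rmorphXn.
  rewrite -QE; move: v; apply: (van_cancelX (n := D.+1) ae Q2 an) => v vC.
  have := EC v vC; rewrite raddf_sum /= big_ord_recl => Ev.
  rewrite mevalM rmorphXn /= QE; apply: (mulfI d0).
  rewrite mulr0 -[RHS](mulr0 (T.@[v] ^+ D)) -[in RHS]Ev !mulrDr; congr (_ + _).
    rewrite mevalZ !mevalM !rmorphXn /= bin1 expr0 subn0 -exprMn -bq // exprMn.
    by rewrite [T.@[v] ^+ D.+1]exprS; ring.
  rewrite !mulr_sumr; apply: eq_bigr => j _; rewrite mevalZ !mevalM !rmorphXn /=.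
  rewrite c_eval /bump leq0n add1n subSS.
  have jD : (j <= D)%N by rewrite -ltnS.
  have -> : a.@[v] ^+ D.+1 = a.@[v] ^+ j.+1 * a.@[v] ^+ (D - j).
    by rewrite -exprD addSn subnKC.
  have -> : T.@[v] ^+ D = T.@[v] ^+ j * T.@[v] ^+ (D - j) by rewrite -exprD subnKC.
  have : a.@[v] ^+ (D - j) * q.@[v] ^+ (D - j) = T.@[v] ^+ (D - j) * b.@[v] ^+ (D - j).
    by rewrite -!exprMn bq.
  set A1 := _ ^+ (D - j); set A2 := _ ^+ (D - j); set A3 := _ ^+ (D - j).
  set A4 := _ ^+ (D - j) => A1234.
  transitivity ('C(d, j.+2)%:R * (polar p j.+2).@[v] * T.@[v] ^+ j * a.@[v] ^+ j.+1 * (A1 * A2)).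
    by field.
  by rewrite A1234; ring.
exists q, (fun v => tri (h 0%N 1%N * v 1 + h 0%N 2%N * v 0 *+ 2 + h 1%N 1%N * v 2%:R)
  (h 0%N 0%N * v 1 *+ 2 + h 0%N 1%N * v 0 + h 1%N 0%N * v 2%:R)
  (h 1%N 0%N * v 1 + h 1%N 1%N * v 0 + h 2%N 0%N * v 2%:R *+ 2)); split=> //.
  by move=> u v s; rewrite !qE sum3 !triE; ring.
(* Every c j vanishes at p, since all polars of p take the value phi p = 0 there. *)
have := qC p pC; rewrite big1 ?addr0 => [/eqP|j _]; first by rewrite expf_eq0 => /andP[_ /eqP].
have jd : (j.+2 <= d)%N by rewrite dD !ltnS -ltnS.
by rewrite c_eval polar_self // pC mul0r mulr0 mul0r.
Qed.

Lemma form_Phi : form_of_degree d Phi.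
Proof. by move=> s v; rewrite !Phi_eval phi_scale. Qed.

Lemma polar_expand j v (x y : K) : (j <= d)%N ->
  (polar p j).@[fun i => x * v i + y * p i] =
  \sum_(k < j.+1) 'C(j, k)%:R * x ^+ k * y ^+ (j - k) * (polar p k).@[v].
Proof.
move=> jd; under [RHS]eq_bigr => k _ do rewrite polar_eval mulr_sumr.
rewrite exchange_big polar_eval /=; apply: eq_bigr => i _; rewrite addrC exprDn mulr_sumr.
apply: eq_bigr => k _; have kj : (k <= j)%N by rewrite -ltnS.
rewrite !exprMn -mulr_natl.
have -> : p i ^+ (d - k) = p i ^+ (d - j) * p i ^+ (j - k).
  by rewrite -exprD; congr (_ ^+ _); lia.
by ring.
Qed.

Lemma phi_expand_on_curve v (x y : K) : phi (fun i => x * v i + y * p i) =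
  d%:R * x * y ^+ D.+1 * T.@[v] +
  \sum_(j < D.+1) 'C(d, j.+2)%:R * x ^+ j.+2 * y ^+ (D - j) * (polar p j.+2).@[v].
Proof.
rewrite (phi_expand d p) -(big_mkord xpredT (fun k => 'C(d, k)%:R * x ^+ k *
  y ^+ (d - k) * (polar p k).@[v])) big_nat_recl // polar0 pC mulr0 add0r.
rewrite [X in \big[_/_]_(_ <= _ < X) _]dD big_nat_recl // bin1 expr1.
rewrite (_ : d - 1 = D.+1)%N; last by rewrite dD subn1.
by congr (_ + _); rewrite big_mkord; apply: eq_bigr => j _; rewrite [in y ^+ _]dD.
Qed.

(** With w(v) = T(v) v + q(v) p, the form Phi(w(v)) vanishes on C and is thus a multiple of Phi. Its
    restriction to the lines through p first makes l, the speed of w along these lines, a multiple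
    of T, and then makes q vanish on the tangent line T = 0. *)
Lemma linear_quotient_on_curve :
  exists l : 'I_3 -> K, forall v, phi v = 0 -> b.@[v] = a.@[v] * \sum_i l i * v i.
Proof.
have [q [B [q2 qD bq qp]]] := quadratic_quotient.
have TE v : T.@[v] = \sum_i p i ^+ (d - 1) * v i.
  by rewrite polar_eval; apply: eq_bigr => i _; rewrite expr1.
have T1 : form_of_degree 1 T by exact: form_polar.
have TD u v s : T.@[fun i => u i + s * v i] = T.@[u] + s * T.@[v].
  by rewrite !TE mulr_sumr -big_split; apply: eq_bigr => i _ /=; ring.
have Tp : T.@[p] = 0 by rewrite polar_self.
have Tn0 : T != 0 by exact: (polar1_neq0 d pi0).
have Tnv : ~ van T by exact: (polar1_nvan d0 d4 pi0).
have Tt v t : T.@[fun i => v i + t * p i] = T.@[v] by rewrite TD Tp mulr0 addr0.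
have Bself v : \sum_i B v i * v i = 2 * q.@[v].
  have := qD v v 1; rewrite (_ : q.@[_] = 2 ^+ 2 * q.@[v]); last first.
    by rewrite -q2; apply: meval_eq => i; ring.
  move=> E1; apply: (addrI (q.@[v] *+ 2)).
  transitivity (q.@[v] + 1 * (\sum_i B v i * v i) + 1 ^+ 2 * q.@[v]); first by ring.
  by rewrite -E1; ring.
(* Chosen so that q(v + t p) = q(v) + t (l(v) - T(v)), which amounts to w(v + t p) = w(v) + t l(v)
   p. *)
pose lc i := p i ^+ (d - 1) + B p i.
pose l v := \sum_i lc i * v i.
have lE v : l v = T.@[v] + \sum_i B p i * v i.
  by rewrite TE -big_split; apply: eq_bigr => i _ /=; rewrite mulrDl.
have lD u v s : l (fun i => u i + s * v i) = l u + s * l v.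
  by rewrite /l mulr_sumr -big_split; apply: eq_bigr => i _ /=; ring.
have qt v t : q.@[fun i => v i + t * p i] = q.@[v] + t * (l v - T.@[v]).
  by rewrite qD qp lE; ring.
have lp : l p = 0 by rewrite lE Bself qp Tp mulr0 addr0.
pose w v i := T.@[v] * v i + q.@[v] * p i.
have [S [SE Sv]] : exists S : {mpoly K[3]}, (forall v, S.@[v] = phi (w v)) /\ van S.
  exists (Phi \mPo shift T q); split; first by move=> v; rewrite shift_eval Phi_eval.
  have Sf := form_shift p T1 q2 form_Phi.
  apply: (van_cancelX (n := d) ae Sf an) => v vC.
  rewrite mevalM rmorphXn /= (shift_prop form_Phi (bq v vC)).
  by rewrite shift_eval Phi_eval abC // mulr0.
have [g SPg] := van_dvd d0 Sv; clear Sv.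
(* Along v + t p, [S] and [Phi] both have degree at most d - 1 in t, so their
   quotient [g] is constant there. *)
have R v k : T.@[v] != 0 -> (k < d)%N ->
    l v ^+ k * (polar p (d - k)).@[w v] = l v ^+ d.-1 * T.@[v] * (polar p (d - k)).@[v].
  move=> Tv kd.
  have szP u : (size (line_poly u p Phi) <= d)%N.
    apply/leq_sizeP => j; rewrite leq_eqVlt => /predU1P[<-|dj].
      by rewrite coef_line_phi // subnn polar0 pC mulr0.
    by rewrite line_phiE coef_poly ltnS leqNgt dj.
  pose r : {poly K} := \poly_(j < d) (l v ^+ j * (line_poly (w v) p Phi)`_j).
  have rE : line_poly v p S = r.
    apply/eqP; rewrite -subr_eq0; apply/eqP/poly_fun_eq0 => t.
    rewrite hornerD hornerN line_polyE SE horner_poly.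
    transitivity (phi (fun i => w v i + (t * l v) * p i) -
        (line_poly (w v) p Phi).[t * l v]).
      congr (_ - _); last first.
        rewrite (horner_coef_wide _ (szP _)); apply: eq_bigr => j _.
        by rewrite exprMn; ring.
      by apply: eq_bigr => i _; congr (_ ^+ _); rewrite /w Tt qt; ring.
    by rewrite line_polyE Phi_eval subrr.
  have sP : size (line_poly v p Phi) = d.
    by apply/eqP; rewrite eqn_leq szP (size_line_phi d0 char0 Tv).
  have [gam gE] : exists gam, line_poly v p g = gam%:P.
    exists (line_poly v p g)`_0; apply: size1_polyC.
    have [->|lg] := eqVneq (line_poly v p g) 0; first by rewrite size_poly0.
    have lP : line_poly v p Phi != 0 by rewrite -size_poly_gt0 sP.
    have := size_poly d (fun j => l v ^+ j * (line_poly (w v) p Phi)`_j).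
    rewrite -/r -rE SPg line_polyM size_mul // sP.
    by move: lg; rewrite -size_poly_gt0; move: (size _) => s; lia.
  have X j : (j < d)%N ->
      l v ^+ j * (polar p (d - j)).@[w v] = gam * (polar p (d - j)).@[v].
    move=> jd; have Cn0 : 'C(d, j)%:R != 0 :> K by rewrite char0 -lt0n bin_gt0 ltnW.
    have := congr1 (fun P : {poly K} => P`_j) rE; rewrite SPg line_polyM gE coefMC.
    rewrite coef_poly jd !coef_line_phi 1?ltnW // => Ej.
    apply: (mulfI Cn0); transitivity (l v ^+ j * ('C(d, j)%:R * (polar p (d - j)).@[w v])).
      by ring.
    by rewrite -Ej; ring.
  (* The constant is read off at t^(d-1): since T(p) = 0, T(w(v)) is just T(v)^2. *)
  have gamE : gam = l v ^+ d.-1 * T.@[v].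
    have := X d.-1; rewrite (_ : d - d.-1 = 1)%N; last by rewrite -{1}(prednK dp) subSnn.
    rewrite -/T prednK // => /(_ (leqnn _)).
    rewrite (_ : T.@[w v] = T.@[v] * T.@[v]).
      by rewrite mulrA => /(mulIf Tv).
    rewrite /w (TD (fun i => T.@[v] * v i)) Tp mulr0 addr0.
    exact: (T1 T.@[v] v).
  by rewrite X // gamE.
(* The case k = 0 of R, divided by T, reads T (...) = l^(d-1) Phi. Where T(u) = 0 and l(u) != 0, the
   whole line u + t p would lie in the cone, as T and l are constant along it; then u is a multiple
   of p, and l(p) = 0 is a contradiction. *)
have lT u : T.@[u] = 0 -> l u = 0.
  have key x : ((d%:R *: T) * (q ^+ D.+1 + \sum_(j < D.+1) c j * q ^+ (D.+1 - j.+1))).@[x] =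
      (lform lc ^+ d.-1 * Phi).@[x].
    apply: (mpoly_fun_dense Tn0) => {}x Tx.
    have := R x 0 Tx dp; rewrite expr0 mul1r subn0 !polard => Rx.
    rewrite !mevalM rmorphXn /= Phi_eval lform_eval; apply: (mulIf Tx).
    transitivity (phi (w x)); last by rewrite Rx /l; ring.
    have QE : (\sum_(j < D.+1) c j * q ^+ (D.+1 - j.+1)).@[x] =
        \sum_(j < D.+1) (c j).@[x] * q.@[x] ^+ (D.+1 - j.+1).
      by rewrite raddf_sum /=; apply: eq_bigr => j _; rewrite mevalM rmorphXn.
    rewrite /w phi_expand_on_curve mevalD mevalZ QE rmorphXn /=.
    move: T.@[x] (c_eval ^~ x) => t cE.
    rewrite mulrAC mulrDr; congr (_ + _); first by ring.
    rewrite mulr_sumr; apply: eq_bigr => j _.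
    by rewrite cE subSS exprSr exprSr; field.
  have := key u; rewrite mevalM mevalZ => + Tu; rewrite Tu mulr0 mul0r => /esym /eqP.
  rewrite mevalM rmorphXn /= lform_eval Phi_eval -[(\sum_i lc i * u i)]/(l u).
  rewrite mulf_eq0 expf_eq0 => /orP[/andP[_ /eqP //]|_].
  apply/eqP/negP => /negP lu.
  have [|k uk] := no_line d0 d4 char0 pi0 (u := u).
    move=> t; have := key (fun i => u i + t * p i).
    rewrite mevalM mevalZ Tt Tu mulr0 mul0r => /esym /eqP.
    rewrite mevalM rmorphXn /= lform_eval Phi_eval.
    rewrite -[(\sum_i lc i * _)]/(l (fun i => u i + t * p i)) lD lp mulr0 addr0.
    by rewrite mulf_eq0 expf_eq0 (negPf lu) andbF => /eqP.
  move/eqP: lu; apply; have -> : l u = k * l p; last by rewrite lp mulr0.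
  by rewrite /l mulr_sumr; apply: eq_bigr => i _; rewrite uk; ring.
pose v0 i : K := (i == i0)%:R / p i ^+ (d - 1).
have Tv0 : T.@[v0] = 1.
  rewrite TE (bigD1 i0) //= big1 => [|i /negPf ni]; last by rewrite /v0 ni mul0r mulr0.
  by rewrite /v0 eqxx mul1r addr0 divff // expf_neq0.
pose cc := l v0.
have lcc u : l u = cc * T.@[u].
  have : l (fun i => u i + - T.@[u] * v0 i) = 0 by apply: lT; rewrite TD Tv0 mulr1 subrr.
  by rewrite lD mulNr => /eqP; rewrite subr_eq0 mulrC => /eqP.
(* For cc = 0 the map w is constant on the lines through p, which invertibility forbids. *)
have cc0 : cc != 0.
  apply/eqP => cc0; apply: (collapse_contra T1 q2 Tt _ Tnv bq) => v t.
  by rewrite qt lcc cc0 mul0r sub0r mulrN.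
have R' v j : T.@[v] != 0 -> (1 <= j <= d)%N ->
    (polar p j).@[w v] = (cc * T.@[v]) ^+ j.-1 * T.@[v] * (polar p j).@[v].
  move=> Tv /andP[j1 jd]; have jd' : (d - j < d)%N by lia.
  have := R v _ Tv jd'; rewrite subKn // lcc => E1.
  have ccT : (cc * T.@[v]) ^+ (d - j) != 0 by rewrite expf_neq0 // mulf_neq0.
  apply: (mulfI ccT); rewrite E1 !mulrA -exprD; congr (_ ^+ _ * _ * _); lia.
(* Modulo T, [R'] for j = 3 and j = 4 gives q (M + q) = 0 and
   q^2 (3 M + 2 q) = 0 with M = polar p 2; this is where d >= 4 is needed. *)
have qT u : T.@[u] = 0 -> q.@[u] = 0.
  pose F3 : {mpoly K[3]} := 3 *: (q * polar p 2) + 3 *: (q ^+ 2).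
  pose F4 : {mpoly K[3]} := 6 *: (q ^+ 2 * polar p 2) + 4 *: (q ^+ 3) +
     4 *: (T * (q * polar p 3)).
  have key3 x : F3.@[x] = ((cc ^+ 2 - 1) *: (T * polar p 3)).@[x].
    apply: (mpoly_fun_dense Tn0) => {}x Tx.
    have T20 : T.@[x] ^+ 2 != 0 by rewrite expf_neq0.
    have d3 : (3 <= d)%N by exact: leq_trans d4.
    have := R' x 3 Tx d3; rewrite /w polar_expand // !big_ord_recr big_ord0 /= polar0 pC.
    rewrite (_ : polar p 1 = T) // /F3 !mevalD !mevalZ !mevalM ?rmorphXn /=.
    rewrite (_ : 'C(3, 1) = 3)%N // (_ : 'C(3, 2) = 3)%N // binn.
    move: T.@[x] q.@[x] (polar p 2).@[x] (polar p 3).@[x] T20 => t y M2 M3 T20 E1.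
    apply: (mulIf T20); transitivity (cc ^+ 2 * t ^+ 2 * t * M3 - t ^+ 3 * M3); last by ring.
    transitivity ((cc * t) ^+ 3.-1 * t * M3 - t ^+ 3 * M3); last by rewrite exprMn.
    by rewrite -E1; ring.
  have key4 x : F4.@[x] = ((cc ^+ 3 - 1) *: (T ^+ 2 * polar p 4)).@[x].
    apply: (mpoly_fun_dense Tn0) => {}x Tx.
    have T20 : T.@[x] ^+ 2 != 0 by rewrite expf_neq0.
    have := R' x 4 Tx d4; rewrite /w polar_expand // !big_ord_recr big_ord0 /= polar0 pC.
    rewrite (_ : polar p 1 = T) // /F4 !mevalD !mevalZ !mevalM ?rmorphXn /=.
    rewrite (_ : 'C(4, 1) = 4)%N // (_ : 'C(4, 2) = 6)%N // (_ : 'C(4, 3) = 4)%N // binn.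
    move: T.@[x] q.@[x] (polar p 2).@[x] (polar p 3).@[x] (polar p 4).@[x] T20 =>
      t y M2 M3 M4 T20 E1.
    apply: (mulIf T20); transitivity (cc ^+ 3 * t ^+ 3 * t * M4 - t ^+ 4 * M4); last by ring.
    transitivity ((cc * t) ^+ 4.-1 * t * M4 - t ^+ 4 * M4); last by rewrite exprMn.
    by rewrite -E1; ring.
  move=> Tu; have := key3 u; have := key4 u.
  rewrite /F3 /F4 !mevalD !mevalZ !mevalM ?rmorphXn /= Tu !mul0r !mulr0 addr0.
  move: q.@[u] (polar p 2).@[u] => y M2 E4 E3.
  apply/eqP/negP => /negP y0.
  have y20 : y ^+ 2 != 0 by rewrite expf_neq0.
  have {}E3 : M2 = - y.
    have n3 : 3 * y != 0 by rewrite mulf_neq0 // char0.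
    apply: (mulfI n3); apply/eqP; rewrite -subr_eq0; apply/eqP.
    by rewrite -[RHS]E3; ring.
  case/negP: (mulf_neq0 (mulf_neq0 (negbT (char0 2)) y0) y20).
  by apply/eqP; rewrite -[RHS]oppr0 -E4 E3; ring.
(* Since T(v0) = 1, each u is u' + T(u) v0 with T(u') = 0. Expanding q there and using q(u') = 0
   leaves T(u) times this linear form. *)
pose lf i := B v0 i - p i ^+ (d - 1) * q.@[v0].
have qTl u : q.@[u] = T.@[u] * \sum_i lf i * u i.
  pose u' i := u i - T.@[u] * v0 i.
  have Tu' : T.@[u'] = 0.
    rewrite (_ : T.@[u'] = T.@[fun i => u i + - T.@[u] * v0 i]).
      by rewrite TD Tv0 mulr1 subrr.
    by apply: meval_eq => i; rewrite mulNr.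
  have -> : q.@[u] = q.@[fun i => u' i + T.@[u] * v0 i].
    by apply: meval_eq => i; rewrite /u' subrK.
  rewrite qD (qT _ Tu') add0r.
  have -> : \sum_i B v0 i * u' i = \sum_i B v0 i * u i - T.@[u] * (2 * q.@[v0]).
    by rewrite -Bself mulr_sumr -sumrB; apply: eq_bigr => i _; rewrite /u'; ring.
  have -> : \sum_i lf i * u i = \sum_i B v0 i * u i - q.@[v0] * T.@[u].
    by rewrite [in RHS]TE mulr_sumr -sumrB; apply: eq_bigr => i _; rewrite /lf; ring.
  ring.
exists lf => v vC.
have fe : form_of_degree e.+1 (b - a * lform lf).
  apply: form_of_degreeB => //.
  by apply: (form_eq (form_of_degreeM ae (form_lform lf))); rewrite addn1.
have : van (T ^+ 1 * (b - a * lform lf)).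
  move=> u uC; rewrite expr1 mevalM mevalB mevalM (lform_eval lf) mulrBr bq // qTl.
  by rewrite mulrCA subrr.
move=> /(van_cancelX T1 fe Tnv) /(_ v vC) /eqP.
by rewrite mevalB mevalM lform_eval subr_eq0 => /eqP.
Qed.

End OnCurve.

Theorem linear_quotient : exists2 l : 'I_3 -> K,
  (forall v, phi v = 0 -> b.@[v] = a.@[v] * \sum_i l i * v i) &
  1 + \sum_i l i * p i != 0.
Proof.
have [l lE] : exists l : 'I_3 -> K,
    forall v, phi v = 0 -> b.@[v] = a.@[v] * \sum_i l i * v i.
  have [pC|pC] := eqVneq (phi p) 0; [exact: linear_quotient_on_curve|exact: linear_quotient_off_curve].
by exists l => //; apply: linear_quotient_unit.
Qed.

End Quotient.
End Centre.

End LinearQuotient.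

(** * Homologies preserving the Fermat curve *)

Section Homologies.
Variables (K : closedFieldType) (d : nat).
Hypothesis d0 : d%:R != 0 :> K.
Hypothesis d4 : (4 <= d)%N.
Hypothesis char0 : forall n : nat, (n%:R == 0 :> K) = (n == 0)%N.
Implicit Types (f g : {mpoly K[3]}) (v : 'I_3 -> K).
Local Notation phi := (phi d).
Local Notation van := (van d).
Local Notation Phi := (Phi K d).

Let dp : (0 < d)%N. Proof. by case: (d) d0; rewrite ?eqxx. Qed.

Definition homology (p l : 'I_3 -> K) v i := v i + (\sum_j l j * v j) * p i.

Lemma homology_ext p l u v i : u =1 v -> homology p l u i = homology p l v i.
Proof. by move=> uv; rewrite /homology uv; under eq_bigr => j _ do rewrite uv. Qed.

Definition scaling_at (p l : 'I_3 -> K) a :=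
  [/\ p a != 0, forall k, k != a -> p k = 0 /\ l k = 0 & (1 + l a * p a) ^+ d = 1].

(** Here 1 + l(p) = -1: the homology is a reflection that exchanges the lines spanned by e_a and e_b
    and fixes the third basis vector. *)
Definition swap_at (p l : 'I_3 -> K) a b :=
  [/\ a != b, p a ^+ d = (- p b) ^+ d, l a * p a = - 1, l b * p b = - 1 &
      forall k, k != a -> k != b -> p k = 0 /\ l k = 0].

Lemma third_index (a b : 'I_3) : a != b -> exists c, [/\ c != a, c != b &
  forall (V : nmodType) (F : 'I_3 -> V), \sum_i F i = F a + F b + F c].
Proof.
move=> ab; have [c ca cb] : exists2 c, c != a & c != b.
  by move: a b ab; apply: ord3P; apply: ord3P => // _;
    [exists 2%:R|exists 1|exists 2%:R|exists 0|exists 1|exists 0].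
exists c; split=> // V F.
rewrite (bigD1 a) //= (bigD1 b) 1?eq_sym //= (bigD1 c) ?ca ?cb //= big1 ?addr0 ?addrA // => k.
case/andP=> /andP[ka kb] kc; exfalso; move: ab ca cb ka kb kc.
by move: a b c k; do 4 (apply: ord3P).
Qed.

(** The derivative at s = 0 of a constant function of s. The two families of powers allow a
    difference of power sums to be differentiated, as mixed second derivatives require. *)
Lemma derive_power_sum (I : finType) (a b c a' c' : I -> K) n e :
  (forall s, \sum_i (c i * (a i + s * b i) ^+ n + c' i * (a' i + s * b i) ^+ n) = e) ->
  n%:R * \sum_i b i * (c i * a i ^+ n.-1 + c' i * a' i ^+ n.-1) = 0.
Proof.
move=> E; pose P : {poly K} := \sum_i (c i *: ((a i)%:P + b i *: 'X) ^+ n +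
   c' i *: ((a' i)%:P + b i *: 'X) ^+ n).
have PE : P = e%:P.
  apply/eqP; rewrite -subr_eq0; apply/eqP/poly_fun_eq0 => s.
  rewrite hornerD hornerN hornerC -[X in _ - X](E s) horner_sum.
  apply/eqP; rewrite subr_eq0; apply/eqP/eq_bigr => i _.
  by rewrite !hornerE !(mulrC (b i)).
have := congr1 (fun q : {poly K} => q^`().[0]) PE; rewrite derivC horner0 => P0.
apply: etrans P0; rewrite /P raddf_sum horner_sum mulr_sumr /=.
apply: eq_bigr => i _.
rewrite derivD !derivZ !deriv_exp !derivD !derivC !derivZ derivX !add0r.
rewrite !hornerE !hornerMn !hornerE /= !mulrnAr -mulrnDl -mulrA mulr_natl; congr (_ *+ n); ring.
Qed.

Section Invariance.
Variables (p l : 'I_3 -> K) (i0 : 'I_3).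
Hypothesis pi0 : p i0 != 0.
Hypothesis lp : 1 + \sum_i l i * p i != 0.

Lemma homologyZ v t i :
  homology p l (fun i => t * v i) i = t * homology p l v i.
Proof.
rewrite /homology; have -> : \sum_j l j * (t * v j) = t * \sum_j l j * v j.
  by rewrite mulr_sumr; apply: eq_bigr => j _; ring.
by ring.
Qed.

(** By [van_dvd] the factor is a polynomial. It is unchanged under scaling of v, hence constant
    along the line through v and the origin, so its value at the origin serves as lam. *)
Lemma homology_invariant : (forall v, phi v = 0 -> phi (homology p l v) = 0) ->
  exists lam, forall v, phi (homology p l v) = lam * phi v.
Proof.
move=> inv; pose f := Phi \mPo shift p 1 (lform l).
have fE v : f.@[v] = phi (homology p l v).
  rewrite shift_eval Phi_eval; apply: eq_bigr => i _.
  by rewrite meval1 mul1r lform_eval.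
have [g fPg] : exists g, f = Phi * g.
  by apply: (van_dvd d0) => v vC; rewrite fE inv.
exists (g.@[fun=> 0]) => v.
have gE u : phi (homology p l u) = g.@[u] * phi u.
  by rewrite -fE fPg mevalM Phi_eval mulrC.
have [v0|v0] := eqVneq (phi v) 0; first by rewrite v0 mulr0 inv.
have gt t : t != 0 -> g.@[fun i => 0 + t * v i] = g.@[v].
  move=> t0; have td : t ^+ d * phi v != 0 by rewrite mulf_neq0 // expf_neq0.
  apply: (mulIf td); rewrite -phi_scale.
  have -> : g.@[fun i => 0 + t * v i] = g.@[fun i => t * v i].
    by apply: meval_eq => i; rewrite add0r.
  rewrite -gE phi_scale mulrCA -gE -phi_scale; apply: eq_bigr => i _; congr (_ ^+ _).
  exact: homologyZ.
have : 'X * (line_poly (fun=> 0) v g - (g.@[v])%:P) = 0.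
  apply: poly_fun_eq0 => t; rewrite hornerM hornerX hornerD hornerN hornerC line_polyE.
  by have [->|t0] := eqVneq t 0; rewrite ?mul0r // gt // subrr mulr0.
move/eqP; rewrite mulf_eq0 polyX_eq0 subr_eq0 /= => /eqP lgE.
have := congr1 (fun q : {poly K} => q.[0]) lgE; rewrite hornerC line_polyE gE => <-.
by congr (_ * _); apply: meval_eq => i; rewrite mul0r addr0.
Qed.

Lemma homology_onto w : exists v, forall i, homology p l v i = w i.
Proof.
pose c := (\sum_j l j * w j) / (1 + \sum_i l i * p i).
exists (fun i => w i - c * p i) => i; rewrite /homology.
have -> : \sum_j l j * (w j - c * p j) = \sum_j l j * w j - c * \sum_j l j * p j.
  by rewrite mulr_sumr -sumrB; apply: eq_bigr => j _; ring.
by rewrite /c; move: (\sum_j l j * p j) lp => x x0; field.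
Qed.

Lemma homologyD v u s i : homology p l (fun i => v i + s * u i) i =
  homology p l v i + s * homology p l u i.
Proof.
rewrite /homology.
have -> : \sum_j l j * (v j + s * u j) = \sum_j l j * v j + s * \sum_j l j * u j.
  by rewrite mulr_sumr -big_split; apply: eq_bigr => j _ /=; ring.
by ring.
Qed.

(** The mixed second derivative of phi in two basis directions is zero. Transported by the matrix M
    of the homology, it becomes the sum over k' of M i k' M j k' w_k'^(d-2) = 0; taking w = e_k
    isolates one column. *)
Lemma monomial_of_invariant lam : (forall v, phi (homology p l v) = lam * phi v) ->
  forall i j k, i != j ->
  ((i == k)%:R + l i * p k) * ((j == k)%:R + l j * p k) = 0.
Proof.
move=> inv i j k ij; pose M (i k : 'I_3) : K := (i == k)%:R + l i * p k.
have [v vE] := homology_onto (fun k' => (k == k')%:R).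
pose e (i k : 'I_3) : K := (k == i)%:R.
have ME i' k' : homology p l (e i') k' = M i' k'.
  rewrite /homology /M /e (bigD1 i') //= eqxx big1 => [|m /negPf ->]; last by rewrite mulr0.
  by rewrite mulr1 addr0 eq_sym.
pose w (k' : 'I_3) : K := (k == k')%:R.
have E s t : phi (fun k' => (w k' + t * M j k') + s * M i k') =
    lam * \sum_k' ((v k' + t * e j k') + s * e i k') ^+ d.
  rewrite -inv; apply: eq_bigr => k' _; congr (_ ^+ _).
  by rewrite !homologyD !ME vE.
(* Subtracting the value at t = 0 removes the dependence on s, because i != j separates the two
   directions on the right. *)
have E1 t s : \sum_k' (1 * ((w k' + t * M j k') + s * M i k') ^+ d +
    (-1) * (w k' + s * M i k') ^+ d) =
    lam * \sum_k' ((v k' + t * e j k') ^+ d - v k' ^+ d).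
  have := E s t; have := E s 0; rewrite /phi => Es0 Est.
  transitivity (lam * (\sum_k' ((v k' + t * e j k') + s * e i k') ^+ d) -
     lam * (\sum_k' ((v k' + 0 * e j k') + s * e i k') ^+ d)).
    rewrite -Est -Es0 -sumrB; apply: eq_bigr => k' _.
    by rewrite mul0r addr0; ring.
  rewrite -mulrBr -sumrB; congr (_ * _); apply: eq_bigr => k' _.
  rewrite mul0r addr0 /e; have [->|ki] := eqVneq k' i.
    by rewrite (negPf ij) !mulr0 !addr0 subrr subrr.
  by rewrite !mulr0 !addr0.
have E2 t : \sum_k' (M i k' * (w k' + t * M j k') ^+ d.-1 + 0 * (0 + t * M j k') ^+ d.-1) =
    \sum_k' M i k' * w k' ^+ d.-1.
  have /eqP := derive_power_sum (E1 t); rewrite mulf_eq0 (negPf d0) /= => /eqP S0.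
  apply/eqP; rewrite -subr_eq0 -sumrB -[X in _ == X]S0; apply/eqP/eq_bigr => k' _.
  ring.
have := derive_power_sum E2 => /eqP; rewrite mulf_eq0 char0.
rewrite (bigD1 k) //= big1 => [|k' k'k].
  rewrite /w eqxx !expr1n mul0r !addr0 mulr1 => /orP[|/eqP H].
    by case: (d) d4 => [|[|]].
  by rewrite [RHS](esym H) mulrC.
rewrite /w eq_sym (negPf k'k) mul0r addr0 expr0n.
by case: (d) d4 => [|[|[|]]] //= ? _; rewrite mulr0 mulr0.
Qed.

Theorem homology_cases : (forall v, phi v = 0 -> phi (homology p l v) = 0) ->
  [\/ forall i, l i = 0, exists a, scaling_at p l a | exists a b, swap_at p l a b].
Proof.
move=> inv; have [lam lamE] := homology_invariant inv.
have mon := monomial_of_invariant lamE.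
have [l0|/existsNP[a /eqP la]] := pselect (forall i, l i = 0); first by constructor 1.
pose e (i k : 'I_3) : K := (k == i)%:R.
have phi_e i : phi (e i) = 1.
  rewrite /phi (bigD1 i) //= big1 => [|k /negPf ki]; last by rewrite /e ki expr0n (gtn_eqF dp).
  by rewrite /e eqxx expr1n addr0.
have homE i k : homology p l (e i) k = (k == i)%:R + l i * p k.
  rewrite /homology (bigD1 i) //= big1 => [|k' /negPf k'i]; last by rewrite /e k'i mulr0.
  by rewrite /e eqxx mulr1 addr0.
(* A basis vector in the kernel of l is fixed, which determines the factor lam. *)
have lam1 c : l c = 0 -> lam = 1.
  move=> lc; have := lamE (e c); rewrite phi_e mulr1 => <-.
  by rewrite -[RHS](phi_e c); apply: eq_bigr => k _; rewrite homE lc mul0r addr0.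
have others b j : b != a -> p b != 0 -> j != a -> (j == b)%:R + l j * p b = 0.
  move=> ba pb ja; have := mon a j b; rewrite eq_sym => /(_ ja) /eqP.
  by rewrite (eq_sym a b) (negPf ba) add0r mulf_eq0 mulf_eq0 (negPf la) (negPf pb) => /eqP.
(* If p b != 0 for some b != a, the entry l a p b is the only nonzero one of its column, which leads
   to an exchange of a and b. Otherwise p is a coordinate vector and the homology scales one
   coordinate. *)
have [[b ba pb]|nb] := pselect (exists2 b, b != a & p b != 0).
  constructor 3; exists a, b.
  have lb : l b * p b = - 1.
    by have /eqP := others b b ba pb ba; rewrite eqxx addrC addr_eq0 => /eqP.
  have ab : a != b by rewrite eq_sym.
  have [c [ca cb sumE]] := third_index ab.
  have lc : l c = 0.
    have /eqP := others b c ba pb ca.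
    by rewrite (negPf cb) add0r mulf_eq0 (negPf pb) orbF => /eqP.
  have pc : p c = 0.
    apply/eqP/negP => /negP pc; have /eqP := others c c ca pc ca.
    by rewrite eqxx lc mul0r addr0 oner_eq0.
  have pa : p a != 0.
    apply: contraNneq lp => pa; rewrite sumE pa lc lb mulr0 mul0r addr0 add0r subrr.
    by [].
  have lap : l a * p a = - 1.
    have := mon b a a ba; rewrite (negPf ba) add0r eqxx => /eqP.
    rewrite !mulf_eq0 (negPf pa) orbF; have [lb0|/=] := eqVneq (l b) 0.
      by move/eqP: lb; rewrite lb0 mul0r eq_sym oppr_eq0 oner_eq0.
    by move=> _; rewrite addrC addr_eq0 => /eqP.
  have lamE1 := lam1 c lc.
  split=> //; last first.
    move=> k ka kb; suff -> : k = c by [].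
    by move: ca cb ka kb ab {sumE}; clear; move: a b c k; do 4 (apply: ord3P).
  have := lamE (e a); rewrite lamE1 phi_e mulr1 /phi sumE !homE eqxx (negPf ba) (negPf ca).
  rewrite lap subrr pc mulr0 !add0r expr0n (gtn_eqF dp) add0r addr0 exprMn => E1.
  have E2 : l a ^+ d * p a ^+ d = (- 1) ^+ d by rewrite -exprMn lap.
  have la0 : l a ^+ d != 0 by rewrite expf_neq0.
  by apply: (mulfI la0); rewrite E2 [(- p b) ^+ d]exprNn mulrCA E1 mulr1.
have pk k : k != a -> p k = 0.
  by move=> ka; apply/eqP/negP => /negP pk; apply: nb; exists k.
have ai0 : i0 = a by apply/eqP/negP => /negP /pk; move/eqP: pi0.
have pa : p a != 0 by rewrite -ai0.
have sum_a : \sum_i l i * p i = l a * p a.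
  by rewrite (bigD1 a) //= big1 ?addr0 // => k /pk ->; rewrite mulr0.
have lk k : k != a -> l k = 0.
  move=> ka; have := mon a k a; rewrite eq_sym => /(_ ka) /eqP.
  rewrite eqxx (negPf ka) add0r -sum_a mulf_eq0 (negPf lp) mulf_eq0 (negPf pa) orbF.
  by move/eqP.
constructor 2; exists a; split=> // [k ka|]; first by rewrite pk ?lk.
have [c ca] := exists_ord3_neq a.
have := lamE (e a); rewrite (lam1 c (lk c ca)) phi_e mulr1 => E1; rewrite -[RHS]E1.
rewrite /phi (bigD1 a) //= big1 => [|k ka]; first by rewrite homE eqxx addr0.
by rewrite homE (negPf ka) pk // mulr0 addr0 expr0n (gtn_eqF dp).
Qed.
End Invariance.

Lemma scaling_invariant p l a v : scaling_at p l a ->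
  phi (homology p l v) = phi v /\ 1 + \sum_i l i * p i != 0.
Proof.
case=> pa0 pl lad.
have sum_a u : \sum_i l i * u i = l a * u a.
  by rewrite (bigD1 a) //= big1 ?addr0 // => k /pl[_ ->]; rewrite mul0r.
split; last first.
  rewrite sum_a; apply: contra_eq_neq lad => ->.
  by rewrite expr0n (gtn_eqF dp) eq_sym oner_eq0.
rewrite /phi (bigD1 a) //= [RHS](bigD1 a) //=; congr (_ + _).
  rewrite /homology sum_a (_ : _ + _ = (1 + l a * p a) * v a); last by ring.
  by rewrite exprMn lad mul1r.
by apply: eq_bigr => k /pl[pk _]; rewrite /homology pk mulr0 addr0.
Qed.

Lemma swap_invariant p l a b v : swap_at p l a b ->
  phi (homology p l v) = phi v /\ 1 + \sum_i l i * p i != 0.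
Proof.
case=> ab pab la lb pl; have [c [ca cb sumE]] := third_index ab.
have [pc lc] := pl c ca cb; split; last first.
  rewrite sumE la lb lc mul0r addr0 addrA subrr add0r oppr_eq0 oner_eq0 //.
have pa : p a != 0 by apply: contra_eq_neq la => ->; rewrite mulr0 eq_sym oppr_eq0 oner_eq0.
have pb : p b != 0 by apply: contra_eq_neq lb => ->; rewrite mulr0 eq_sym oppr_eq0 oner_eq0.
have laE : l a = - (p a)^-1 by apply: (mulIf pa); rewrite la mulNr mulVf.
have lbE : l b = - (p b)^-1 by apply: (mulIf pb); rewrite lb mulNr mulVf.
rewrite /phi !sumE /homology sumE lc pc laE lbE !mulr0 !addr0 mul0r addr0.
have -> : v a + (- (p a)^-1 * v a + - (p b)^-1 * v b) * p a = p a / - p b * v b.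
  by field; rewrite ?oppr_eq0 pa pb.
have -> : v b + (- (p a)^-1 * v a + - (p b)^-1 * v b) * p b = - p b / p a * v a.
  by field; rewrite ?oppr_eq0 pa pb.
rewrite !exprMn !exprVn pab divff ?mul1r ?expf_neq0 ?oppr_eq0 //.
by rewrite ?mul1r (addrC (v b ^+ d)).
Qed.

End Homologies.

(** * The group of a point *)

Section RationalMaps.
Variables (K : closedFieldType) (d : nat).
Hypothesis d0 : d%:R != 0 :> K.
Hypothesis d4 : (4 <= d)%N.
Hypothesis char0 : forall n : nat, (n%:R == 0 :> K) = (n == 0)%N.
Implicit Types (f g : {mpoly K[3]}) (v : 'I_3 -> K).
Local Notation phi := (phi d).
Local Notation van := (van d).
Local Notation Phi := (Phi K d).

Let dp : (0 < d)%N. Proof. by case: (d) d0; rewrite ?eqxx. Qed.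

Local Notation C := (fermat_curve K d).

Lemma proj_point_ex (v : 'rV[K]_3) : v != 0 -> exists P : proj_space K 2, line P = <[v]>%VS.
Proof.
move=> v0; have dim1 : \dim <[v]>%VS == 1%N by rewrite dim_vline v0.
by exists (exist _ <[v]>%VS dim1).
Qed.

Lemma fermat_curveE (P : proj_space K 2) (v : 'rV[K]_3) : line P = <[v]>%VS ->
  C P <-> phi (v 0) = 0.
Proof.
move=> Pv; split=> [|vC].
  by move/(_ v); rewrite Pv memv_line -/Phi Phi_eval; apply.
move=> w; rewrite Pv => /vlineP[k ->]; rewrite -/Phi Phi_eval.
rewrite -[RHS](mulr0 (k ^+ d)) -vC -phi_scale.
by apply: eq_bigr => i _; rewrite mxE.
Qed.

Let row_fun v : (\row_i v i : 'rV[K]_3) 0 =1 v.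
Proof. by move=> i; rewrite mxE. Qed.

Let phi_row v : phi ((\row_i v i : 'rV[K]_3) 0) = phi v.
Proof. by apply: eq_bigr => i _; rewrite row_fun. Qed.

Lemma vanishes_onE f : vanishes_on C f <-> van f.
Proof.
have nz (v : 'I_3 -> K) : phi v = 0 -> (\row_i v i : 'rV[K]_3) != 0 ->
    vanishes_on C f -> f.@[v] = 0.
  move=> vC v0; have [P Pv] := proj_point_ex v0.
  move=> /(_ P); rewrite (fermat_curveE Pv) phi_row => /(_ vC (\row_i v i)).
  by rewrite Pv memv_line (meval_eq _ (row_fun v)) => /(_ isT).
split=> [fC v vC|fv P PC v vP].
  have [v0|v0] := eqVneq (\row_i v i : 'rV[K]_3) 0; last exact: nz v0 fC.
  (* Every line contains the origin, so any single point of C gives the condition at v = 0. *)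
  have [u [uC u0]] := cone_point d0.
  have [|P Pu] := @proj_point_ex (\row_i u i).
    by apply/eqP => /rowP/(_ 0); rewrite !mxE u0 => /eqP; rewrite oner_eq0.
  have <- := fC P (proj2 (fermat_curveE Pu) (etrans (phi_row _) uC)) 0 (mem0v _).
  by apply: meval_eq => i; rewrite -row_fun v0.
apply: fv; have := PC v vP.
by rewrite -/Phi Phi_eval.
Qed.

Section Ratmaps.
Variable m : nat.
Implicit Types F G H : m.-tuple {mpoly K[3]}.

Lemma ratmap_eq_refl F : is_ratmap C F -> ratmap_eq C F F.
Proof.
move=> RF; split=> // i j; apply/vanishes_onE => v _.
by rewrite mulrC subrr meval0.
Qed.

Lemma ratmap_eqE F G v i j : ratmap_eq C F G -> phi v = 0 ->
  (tnth F i).@[v] * (tnth G j).@[v] = (tnth F j).@[v] * (tnth G i).@[v].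
Proof.
case=> _ _ /(_ i j) /vanishes_onE FG vC; have := FG v vC.
by rewrite mevalB !mevalM => /eqP; rewrite subr_eq0 => /eqP.
Qed.

Lemma ratmap_eq_sym F G : ratmap_eq C F G -> ratmap_eq C G F.
Proof.
move=> FG; have [RF RG _] := FG; split=> // i j; apply/vanishes_onE => v vC.
by rewrite mevalB !mevalM mulrC (ratmap_eqE j i FG vC) mulrC subrr.
Qed.

Lemma is_ratmap_form F : is_ratmap C F -> exists e, forall i, form_of_degree e (tnth F i).
Proof. by case=> -[e Fe] _; exists e => i; apply: dhomog_form. Qed.

(** The relation between F and H holds after multiplication by a component of G that does not vanish
    on C; irreducibility cancels it. *)
Lemma ratmap_eq_trans F G H : ratmap_eq C F G -> ratmap_eq C G H -> ratmap_eq C F H.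
Proof.
move=> FG GH; have [RF RG _] := FG; have [_ RH _] := GH; split=> // i j.
have [e Fe] := is_ratmap_form RF; have [e' Ge] := is_ratmap_form RG.
have [e'' He] := is_ratmap_form RH.
have [_ [k]] := RG; rewrite vanishes_onE => Gk; apply/vanishes_onE.
have FHe := form_of_degreeB (form_of_degreeM (Fe i) (He j)) (form_of_degreeM (Fe j) (He i)).
have : van (tnth G k * (tnth F i * tnth H j - tnth F j * tnth H i)).
  move=> v vC; rewrite mevalM mevalB !mevalM.
  have := ratmap_eqE i k FG vC; have := ratmap_eqE j k FG vC.
  have := ratmap_eqE i j GH vC.
  move: (tnth G k).@[v] (tnth G i).@[v] (tnth G j).@[v] (tnth F i).@[v] (tnth F j).@[v]
    (tnth F k).@[v] (tnth H i).@[v] (tnth H j).@[v] => gk gi gj fi fj fk hi hj E1 E2 E3.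
  transitivity (fi * gk * hj - fj * gk * hi); first by ring.
  rewrite E3 E2; transitivity (fk * (gi * hj - gj * hi)); first by ring.
  by rewrite E1 subrr mulr0.
by case/(van_domain d0 (Ge k) FHe) => // /Gk.
Qed.

Lemma ratmap_class_eq F G : ratmap_eq C F G -> ratmap_class C F = ratmap_class C G.
Proof.
move=> FG; apply/seteqP; split=> H; rewrite /ratmap_class /=.
  exact/ratmap_eq_trans/ratmap_eq_sym.
exact: ratmap_eq_trans.
Qed.

Lemma ratmap_class_inj F G : is_ratmap C G ->
  ratmap_class C F = ratmap_class C G -> ratmap_eq C F G.
Proof.
move=> RG E; suff : ratmap_class C F G by [].
by rewrite E; apply: ratmap_eq_refl.
Qed.

End Ratmaps.

Definition homology_ratmap (p l : 'I_3 -> K) : 3.-tuple {mpoly K[3]} :=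
  [tuple 'X_i + p i *: lform l | i < 3].

Lemma homology_ratmapE p l v i : (tnth (homology_ratmap p l) i).@[v] = homology p l v i.
Proof.
by rewrite tnth_mktuple mevalD mevalZ mevalXU lform_eval (mulrC (p i)).
Qed.

Lemma lform_homog (l : 'I_3 -> K) : lform l \is 1.-homog.
Proof. by apply: rpred_sum => i _; apply: rpredZ; rewrite dhomogX /= mdeg1. Qed.

Lemma homology_ratmap_homog p l i : tnth (homology_ratmap p l) i \is 1.-homog.
Proof.
rewrite tnth_mktuple; apply: rpredD; first by rewrite dhomogX /= mdeg1.
by apply: rpredZ; apply: lform_homog.
Qed.

Lemma is_ratmap_homology p l : (exists i, p i != 0) -> 1 + \sum_i l i * p i != 0 ->
  is_ratmap C (homology_ratmap p l).
Proof.
move=> [i pi0] lp; split; first by exists 1%N => j; apply: homology_ratmap_homog.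
exists i; rewrite vanishes_onE => Lv.
have sumE v : homology p l v i = \sum_k ((k == i)%:R + p i * l k) * v k.
  under [RHS]eq_bigr => k _ do rewrite mulrDl; rewrite big_split /=; congr (_ + _).
    rewrite (bigD1 i) //= eqxx mul1r big1 ?addr0 // => k /negPf ->.
    by rewrite mul0r.
  by rewrite mulr_suml; apply: eq_bigr => k _; ring.
have /van_lform c0 : van (lform (fun k => (k == i)%:R + p i * l k)).
  by move=> v vC; rewrite -(Lv v vC) homology_ratmapE lform_eval sumE.
have : homology p l p i = 0.
  by rewrite sumE big1 // => k _; rewrite (c0 d0 d4) mul0r.
have -> : homology p l p i = (1 + \sum_i l i * p i) * p i by rewrite /homology mulrDl mul1r.
by apply/eqP; rewrite mulf_neq0.
Qed.

Lemma mpoly_fun_ext f g : (forall v, f.@[v] = g.@[v]) -> f = g.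
Proof.
move=> fg; apply/eqP; rewrite -subr_eq0; apply/eqP/mpoly_fun_eq0 => v.
by rewrite mevalB fg subrr.
Qed.

Section ProjectionGroup.
Variables (P : proj_space K 2) (p : 'rV[K]_3).
Hypotheses (Pp : line P = <[p]>%VS) (p0 : p != 0).

Let A := projection_matrix P.

Let A_spec : is_projection_matrix P A.
Proof. by apply: xgetPex; apply: is_projection_matrix_ex. Qed.

Let pA : p *m A = 0.
Proof. by case: A_spec => _; apply; rewrite Pp memv_line. Qed.

Let kerA (u : 'rV[K]_3) : u *m A = 0 -> exists k, u = k *: p.
Proof.
move=> uA; apply/sub_rVP; have /sub_kermxP uk := uA; have /sub_kermxP pk := pA.
apply: submx_trans uk _; have [rA _] := A_spec.
have := mxrank_leqif_sup pk; rewrite mxrank_ker rA rank_rV p0 => -[_ /esym].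
by rewrite eqxx.
Qed.

Let p_coord : exists i, p 0 i != 0.
Proof.
apply: contrapT => np; case/eqP: p0; apply/rowP => i; rewrite mxE; apply/eqP/negP => /negP pi.
by apply: np; exists i.
Qed.

Let projE j v : (tnth (projection P) j).@[v] = \sum_i A i j * v i.
Proof. by rewrite tnth_mktuple; apply: lform_eval. Qed.

Let mulA_coord (u : 'rV[K]_3) j : (u *m A) 0 j = \sum_i A i j * u 0 i.
Proof. by rewrite mxE; apply: eq_bigr => i _; rewrite mulrC. Qed.

Lemma is_ratmap_projection : is_ratmap C (projection P).
Proof.
split; first by exists 1%N => j; rewrite tnth_mktuple; apply: lform_homog.
apply: contrapT => nv.
have A0 : A = 0.
  apply/matrixP => i j; rewrite mxE.
  have vj : van (lform (A ^~ j)).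
    have : vanishes_on C (tnth (projection P) j).
      by apply: contrapT => h; apply: nv; exists j.
    by rewrite tnth_mktuple vanishes_onE.
  exact: (van_lform d0 d4 vj).
by have [] := A_spec; rewrite A0 mxrank0.
Qed.

(** Exact invariance of phi, rather than of its zeros, is inherited by inverses, and
    [preserving_of_vanishing] shows that it follows from invariance of the zeros. *)
Definition preserving (l : 'I_3 -> K) :=
  1 + \sum_i l i * p 0 i != 0 /\ forall v, phi (homology (p 0) l v) = phi v.

Let inv_form (l : 'I_3 -> K) i := - (l i / (1 + \sum_j l j * p 0 j)).

Let inv_formK l : 1 + \sum_i l i * p 0 i != 0 ->
  forall v i, homology (p 0) (inv_form l) (homology (p 0) l v) i = v i.
Proof.
move=> lp v i; rewrite /homology.
set x := \sum_j l j * v j; set y := 1 + _ in lp.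
have E u : \sum_j inv_form l j * u j = - ((\sum_j l j * u j) / y).
  by rewrite mulr_suml -sumrN; apply: eq_bigr => j _; rewrite /inv_form -/y; ring.
rewrite E (_ : \sum_j l j * (v j + x * p 0 j) = x * y); first by field.
rewrite /y mulrDr mulr1 mulr_sumr -big_split /=; apply: eq_bigr => j _; ring.
Qed.

Let inv_formE l : 1 + \sum_i l i * p 0 i != 0 ->
  1 + \sum_i inv_form l i * p 0 i = (1 + \sum_i l i * p 0 i)^-1.
Proof.
move=> lp; have -> : \sum_i inv_form l i * p 0 i =
    - ((\sum_i l i * p 0 i) / (1 + \sum_i l i * p 0 i)).
  by rewrite mulr_suml -sumrN; apply: eq_bigr => j _; rewrite /inv_form; ring.
by move: (\sum_i l i * p 0 i) lp => x x0; field.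
Qed.

Let preserving_inv l : preserving l -> preserving (inv_form l).
Proof.
case=> lp lphi; have lp' : 1 + \sum_i inv_form l i * p 0 i != 0.
  by rewrite inv_formE // invr_eq0.
split=> // v; have [u uE] := homology_onto lp v.
transitivity (phi (homology (p 0) (inv_form l) (homology (p 0) l u))).
  by apply: eq_bigr => i _; congr (_ ^+ _); apply: homology_ext => k; rewrite uE.
transitivity (phi u); first by apply: eq_bigr => i _; rewrite inv_formK.
by rewrite -lphi; apply: eq_bigr => i _; rewrite uE.
Qed.

Let inv_formKV l : 1 + \sum_i l i * p 0 i != 0 ->
  forall v i, homology (p 0) l (homology (p 0) (inv_form l) v) i = v i.
Proof.
move=> lp v i; have [u uE] := homology_onto lp v; rewrite -uE; apply: homology_ext => k.
by rewrite -(inv_formK lp u); apply: homology_ext => k'; rewrite uE.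
Qed.

Let comp_id l l' :
  (forall v i, homology (p 0) l (homology (p 0) l' v) i = v i) ->
  ratmap_comp (homology_ratmap (p 0) l) (homology_ratmap (p 0) l') = ratmap_id K.
Proof.
move=> ll'; apply/eq_from_tnth => i; apply: mpoly_fun_ext => v.
rewrite !tnth_mktuple comp_mpoly_meval mevalXU -[in RHS](ll' v).
rewrite -homology_ratmapE tnth_mktuple; apply: meval_eq => k; exact: homology_ratmapE.
Qed.

Let is_ratmap_id : is_ratmap C (ratmap_id K).
Proof.
split; first by exists 1%N => i; rewrite tnth_mktuple dhomogX /= mdeg1.
exists 0; rewrite tnth_mktuple vanishes_onE => X0.
have : van (lform (fun i => (i == 0)%:R : K)).
  by move=> v vC; rewrite -(X0 v vC) mevalXU lform_eval (bigD1 0) //= big1 ?mul1r ?addr0 //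
    => i /negPf ->; rewrite mul0r.
by move/(van_lform d0 d4)/(_ 0)/eqP; rewrite eqxx oner_eq0.
Qed.

Let maps_into l : preserving l -> maps_into_itself C (homology_ratmap (p 0) l).
Proof.
case=> _ lphi Q R v QC Qv; rewrite -[ratmap_eval _ _ != 0]/(_ != 0) => Fv0 FvR.
move: QC => /(_ v Qv); rewrite -/Phi Phi_eval => vC.
have [dR] : \dim (line R) = 1%N by case: (R) => V /= /eqP.
have RE : line R = <[ratmap_eval (homology_ratmap (p 0%R) l) v]>%VS.
  by apply/eqP; rewrite eq_sym eqEdim -memvE FvR dR dim_vline Fv0.
rewrite (fermat_curveE RE) -[RHS]vC -(lphi (v 0)); apply: eq_bigr => i _; congr (_ ^+ _).
by rewrite /ratmap_eval mxE homology_ratmapE.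
Qed.

Lemma homology_in_projection_group l : preserving l ->
  projection_group C P (ratmap_class C (homology_ratmap (p 0) l)).
Proof.
move=> pl; have [lp lphi] := pl; have [lp' lphi'] := preserving_inv pl.
exists (homology_ratmap (p 0) l); split=> //.
- split; [exact: is_ratmap_homology|exact: maps_into|].
  exists (homology_ratmap (p 0) (inv_form l)); split.
  + exact: is_ratmap_homology.
  + exact/maps_into/preserving_inv.
  + by rewrite comp_id; [apply: ratmap_eq_refl|apply: inv_formK].
  + by rewrite comp_id; [apply: ratmap_eq_refl|apply: inv_formKV].
rewrite (_ : ratmap_comp _ _ = projection P).
  exact/ratmap_eq_refl/is_ratmap_projection.
apply/eq_from_tnth => j; apply: mpoly_fun_ext => v.
rewrite tnth_mktuple comp_mpoly_meval !projE.
have := mulA_coord p j; rewrite pA mxE => Ap.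
transitivity (\sum_i A i j * v i + (\sum_i l i * v i) * \sum_i A i j * p 0 i).
  rewrite mulr_sumr -big_split /=; apply: eq_bigr => i _.
  by rewrite homology_ratmapE /homology; ring.
by rewrite -Ap mulr0 addr0.
Qed.

(** The minor of the two maps in the coordinates i0 and j is (l - l')(v) L(v), and the linear form L
    does not vanish on C. *)
Lemma homology_ratmap_inj l l' : preserving l -> preserving l' ->
  ratmap_class C (homology_ratmap (p 0) l) = ratmap_class C (homology_ratmap (p 0) l') ->
  l = l'.
Proof.
move=> [lp lphi] [lp' lphi'] /(ratmap_class_inj (is_ratmap_homology p_coord lp')) ll'.
have [i0 pi0] := p_coord; have [j ji] := exists_ord3_neq i0.
pose L : {mpoly K[3]} := lform (fun k => p 0 i0 * (k == j)%:R - p 0 j * (k == i0)%:R).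
have LE v : L.@[v] = p 0 i0 * v j - p 0 j * v i0.
  rewrite lform_eval (bigD1 j) //= (bigD1 i0) 1?eq_sym //= big1 => [|k /andP[/negPf kj /negPf ki]].
    by rewrite !eqxx (eq_sym i0) (negPf ji) /= !mulr1 !mulr0; ring.
  by rewrite kj ki /= !mulr0; ring.
have Ln : ~ van L.
  move/(van_lform d0 d4)/(_ j); rewrite eqxx (negPf ji) mulr0 subr0 mulr1 => /eqP.
  by rewrite (negPf pi0).
have : van (L * lform (fun i => l i - l' i)).
  move=> v vC; have := ratmap_eqE i0 j ll' vC; rewrite !homology_ratmapE /homology => E1.
  rewrite mevalM LE lform_eval.
  have -> : \sum_i (l i - l' i) * v i = \sum_i l i * v i - \sum_i l' i * v i.
    by rewrite -sumrB; apply: eq_bigr => i _; rewrite mulrBl.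
  move: (\sum_i l i * v i) (\sum_i l' i * v i) E1 => x y E1.
  transitivity ((v i0 + x * p 0 i0) * (v j + y * p 0 j) -
     (v j + x * p 0 j) * (v i0 + y * p 0 i0)); first by ring.
  by rewrite E1 subrr.
case/(van_domain d0 (form_lform _) (form_lform _)) => // /(van_lform d0 d4) ll.
by apply/funext => i; apply/eqP; rewrite -subr_eq0 ll.
Qed.

Lemma preserving_of_vanishing l : 1 + \sum_i l i * p 0 i != 0 ->
  (forall v, phi v = 0 -> phi (homology (p 0) l v) = 0) ->
  preserving l /\
  [\/ forall i, l i = 0, exists a, scaling_at d (p 0) l a | exists a b, swap_at d (p 0) l a b].
Proof.
move=> lp lC; have [i0 pi0] := p_coord.
have cases := homology_cases d0 d4 char0 pi0 lp lC; split=> //; split=> // v.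
case: cases => [l0|[a la]|[a [b lab]]].
- apply: eq_bigr => i _; rewrite /homology big1 ?mul0r ?addr0 // => j _.
  by rewrite l0 mul0r.
- by have [] := scaling_invariant d0 v la.
- by have [] := swap_invariant v lab.
Qed.

Lemma projection_group_homology tau : projection_group C P tau ->
  exists2 l, preserving l & tau = ratmap_class C (homology_ratmap (p 0) l).
Proof.
case=> F [[RF Fself [G [RG Gself GF FG]]] -> projF].
have [i0 pi0] := p_coord; have [e Fe] := is_ratmap_form RF; have [n Gn] := is_ratmap_form RG.
have [[_ [j an]] _ _] := projF; move: an; rewrite vanishes_onE => an.
pose m := lform (A ^~ j).
have m1 : form_of_degree 1 m by apply: form_lform.
have mE v : m.@[v] = \sum_i A i j * v i by rewrite lform_eval.
pose a := tnth (ratmap_comp (projection P) F) j.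
have aE v : a.@[v] = \sum_i A i j * (tnth F i).@[v].
  by rewrite /a tnth_mktuple comp_mpoly_meval projE.
have ae : form_of_degree e a.
  move=> s v; rewrite !aE mulr_sumr; apply: eq_bigr => i _.
  by rewrite Fe; ring.
have mn : ~ van m.
  move/(van_lform d0 d4) => Aj; apply: an => v _.
  by rewrite -/a aE big1 // => i _; rewrite Aj mul0r.
(* With m a component of the projection and a = m o F, the vector m F - a v is killed by the
   projection, hence is a multiple of p; b is its factor, read off at i0. *)
pose b := (p 0 i0)^-1 *: (m * tnth F i0 - a * 'X_i0).
have be : form_of_degree e.+1 b.
  apply/form_of_degreeZ/form_of_degreeB; first exact: form_of_degreeM m1 (Fe i0).
  by rewrite -addn1; apply: form_of_degreeM ae (@form_of_degreeX K i0).
have mF v : phi v = 0 -> forall i,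
    m.@[v] * (tnth F i).@[v] = a.@[v] * v i + b.@[v] * p 0 i.
  move=> vC; pose u : 'rV[K]_3 := \row_i (m.@[v] * (tnth F i).@[v] - a.@[v] * v i).
  have [k uk] : exists k, u = k *: p.
    apply: kerA; apply/rowP => j'; rewrite mulA_coord mxE.
    have := ratmap_eqE j j' projF vC; rewrite -/a !projE -mE => E1.
    transitivity (m.@[v] * (\sum_i A i j' * (tnth F i).@[v]) - a.@[v] * \sum_i A i j' * v i).
      rewrite !mulr_sumr -sumrB; apply: eq_bigr => i _; rewrite mxE; ring.
    rewrite E1 tnth_mktuple comp_mpoly_meval projE; ring.
  have uE i : m.@[v] * (tnth F i).@[v] - a.@[v] * v i = k * p 0 i.
    by have /rowP/(_ i) := uk; rewrite !mxE.
  move=> i; apply/eqP; rewrite addrC -subr_eq; apply/eqP; rewrite uE; congr (_ * _).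
  by rewrite mevalZ mevalB !mevalM mevalXU uE mulrC mulfK.
have phiF0 v : phi v = 0 -> (\row_i v i : 'rV[K]_3) != 0 ->
    phi (fun i => (tnth F i).@[v]) = 0.
  move=> vC v0; pose w : 'rV[K]_3 := ratmap_eval F (\row_i v i).
  have wE i : w 0 i = (tnth F i).@[v].
    by rewrite /w /ratmap_eval mxE (meval_eq _ (row_fun v)).
  rewrite (_ : phi _ = phi (w 0)); last by apply: eq_bigr => i _; rewrite wE.
  have [->|w0] := eqVneq w 0.
    by rewrite /phi big1 // => i _; rewrite mxE expr0n (gtn_eqF dp).
  have [Q Qw] := proj_point_ex w0; apply/(fermat_curveE Qw).
  have [R Rv] := proj_point_ex v0.
  have RC : C R by apply/(fermat_curveE Rv); rewrite phi_row.
  by apply: (Fself _ _ _ RC _ w0 _); rewrite ?Rv ?Qw memv_line.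
have phiF v : phi v = 0 -> phi (fun i => (tnth F i).@[v]) = 0.
  move=> vC; have [v0|v0] := eqVneq (\row_i v i : 'rV[K]_3) 0; last exact: phiF0.
  have [u [uC u0]] := cone_point d0.
  have Fu : phi (fun i => (tnth F i).@[u]) = 0.
    apply: phiF0 => //; apply/eqP => /rowP/(_ 0).
    by rewrite !mxE u0 => /eqP; rewrite oner_eq0.
  transitivity ((0 ^+ e) ^+ d * phi (fun i => (tnth F i).@[u])); last by rewrite Fu mulr0.
  rewrite -phi_scale; apply: eq_bigr => i _; rewrite -Fe; congr (_ ^+ _).
  by apply: meval_eq => k; rewrite mul0r -row_fun v0 mxE.
have mFE v : phi v = 0 -> forall f k, form_of_degree k f ->
    (f \mPo shift (p 0) a b).@[v] = m.@[v] ^+ k * f.@[fun i => (tnth F i).@[v]].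
  move=> vC f k fk; rewrite shift_eval -fk; apply: meval_eq => i.
  by rewrite mF.
have [[_ [i1 Gi1]] _ _] := GF; move: Gi1; rewrite vanishes_onE => Gi1.
have GiE v : (tnth (ratmap_comp G F) i1).@[v] = (tnth G i1).@[fun i => (tnth F i).@[v]].
  by rewrite tnth_mktuple comp_mpoly_meval.
have ab_phi v : phi v = 0 -> phi (fun i => a.@[v] * v i + b.@[v] * p 0 i) = 0.
  move=> vC; transitivity (m.@[v] ^+ d * phi (fun i => (tnth F i).@[v])).
    by rewrite -phi_scale; apply: eq_bigr => i _; rewrite mF.
  by rewrite phiF // mulr0.
have GFab v : phi v = 0 -> forall i k, (tnth G i \mPo shift (p 0) a b).@[v] * v k =
    (tnth G k \mPo shift (p 0) a b).@[v] * v i.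
  move=> vC i k; rewrite !(mFE v vC _ n) // -!mulrA; congr (_ * _).
  by have := ratmap_eqE i k GF vC; rewrite !tnth_mktuple !comp_mpoly_meval !mevalXU.
have Gab : ~ van (tnth G i1 \mPo shift (p 0) a b).
  move=> GS; apply: Gi1.
  have Gne : form_of_degree (n * e) (tnth (ratmap_comp G F) i1).
    move=> s v; rewrite !GiE mulnC exprM -(Gn i1); apply: meval_eq => i; exact: Fe.
  apply: (van_cancelX (n := n) d0 m1 Gne mn) => v vC.
  by rewrite mevalM rmorphXn /= GiE -mFE ?GS.
have [l lE lp] := linear_quotient d0 d4 char0 pi0 ae be an ab_phi Gn GFab Gab.
have mFl v : phi v = 0 -> forall i,
    m.@[v] * (tnth F i).@[v] = a.@[v] * homology (p 0) l v i.
  by move=> vC i; rewrite mF // lE // /homology; ring.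
have [pl _] : preserving l /\
    [\/ forall i, l i = 0, exists a, scaling_at d (p 0) l a | exists a b, swap_at d (p 0) l a b].
  apply: preserving_of_vanishing => // v vC.
  pose f := Phi \mPo homology_ratmap (p 0) l.
  have fE u : f.@[u] = phi (homology (p 0) l u).
    rewrite comp_mpoly_meval Phi_eval; apply: eq_bigr => i _.
    by rewrite homology_ratmapE.
  have fd : form_of_degree d f.
    move=> s u; rewrite !fE -phi_scale; apply: eq_bigr => i _.
    by rewrite homologyZ.
  rewrite -fE; move: v vC; apply: (van_cancelX (n := d) d0 ae fd an) => v vC.
  rewrite mevalM rmorphXn /= fE -phi_scale -[RHS](mulr0 (m.@[v] ^+ d)) -[in RHS](phiF _ vC).
  by rewrite -phi_scale; apply: eq_bigr => i _; rewrite mFl.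
exists l => //; apply: ratmap_class_eq; split=> //.
  exact: is_ratmap_homology.
move=> i k; rewrite vanishes_onE.
pose L i := tnth (homology_ratmap (p 0) l) i.
have L1 i' : form_of_degree 1 (L i') by apply/dhomog_form/homology_ratmap_homog.
have W := form_of_degreeB (form_of_degreeM (Fe i) (L1 k)) (form_of_degreeM (Fe k) (L1 i)).
apply: (van_cancelX (n := 1) d0 m1 W mn) => v vC.
rewrite expr1 mevalM mevalB !mevalM mulrBr !mulrA !mFl // !homology_ratmapE.
by ring.
Qed.

End ProjectionGroup.

End RationalMaps.

(** * Orders of the groups *)

Section GroupOrders.
Variables (K : closedFieldType) (d : nat).
Hypothesis d0 : d%:R != 0 :> K.
Hypothesis d4 : (4 <= d)%N.
Hypothesis char0 : forall n : nat, (n%:R == 0 :> K) = (n == 0)%N.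
Implicit Types (f g : {mpoly K[3]}) (v : 'I_3 -> K).
Local Notation phi := (phi d).
Local Notation van := (van d).
Local Notation Phi := (Phi K d).
Local Notation C := (fermat_curve K d).

Let dp : (0 < d)%N. Proof. by case: (d) d0; rewrite ?eqxx. Qed.

Lemma card_eq_finType (T : finType) (U : Type) (f : T -> U) (A : set U) n :
  injective f -> (forall u, A u <-> exists t, f t = u) -> #|T| = n -> (A #= `I_n)%card.
Proof.
move=> finj fA <-.
have -> : A = (f @` [set: T])%classic.
  apply/seteqP; split=> u; first by move/fA => [t <-]; exists t.
  by case=> t _ <-; apply/fA; exists t.
apply: card_eq_trans (inj_card_eq (in2W finj)) _.
rewrite card_eq_sym.
have <- : ((fun t : T => enum_rank t : nat) @` [set: T])%classic = `I_#|T|.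
  apply/seteqP; split=> [k [t _ <-]|k /= kT]; first exact: (ltn_ord (enum_rank t)).
  by exists (enum_val (Ordinal kT)); rewrite // enum_valK.
apply: inj_card_eq => t t' _ _ /= tt'.
by apply/enum_rank_inj/val_inj.
Qed.

Lemma line_inj : injective (@line K 2).
Proof. by move=> P Q; apply: val_inj. Qed.

Lemma line_generator (P : proj_space K 2) :
  exists2 p : 'rV[K]_3, line P = <[p]>%VS & p != 0.
Proof.
case: P => V dV1; rewrite /line /=.
have V0 : V != 0%VS by rewrite -dimv_eq0 (eqP dV1).
exists (vpick V); last by rewrite vpick0.
apply/eqP; rewrite eq_sym eqEdim -memvE memv_pick (eqP dV1) dim_vline.
by rewrite vpick0 V0.
Qed.

Definition coordinate_vector (p : 'I_3 -> K) :=
  exists a, p a != 0 /\ forall k, k != a -> p k = 0.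

Definition swap_vector (p : 'I_3 -> K) :=
  exists a b, [/\ a != b, p a != 0, p a ^+ d = (- p b) ^+ d &
    forall k, k != a -> k != b -> p k = 0].

Let swap_nz (x y : K) : x != 0 -> x ^+ d = (- y) ^+ d -> y != 0.
Proof.
by move=> x0; apply: contra_eq_neq => ->; rewrite oppr0 expr0n (gtn_eqF dp) expf_neq0.
Qed.

Section Group.
Variables (P : proj_space K 2) (p : 'rV[K]_3).
Hypotheses (Pp : line P = <[p]>%VS) (p0 : p != 0).
Local Notation G := (projection_group C P).

Let preservingP l : preserving d p l <->
  [\/ forall i, l i = 0, exists a, scaling_at d (p 0) l a | exists a b, swap_at d (p 0) l a b].
Proof.
have [i pi] : exists i, p 0 i != 0.
  apply: contrapT => np; case/eqP: p0; apply/rowP => i; rewrite mxE; apply/eqP/negP => /negP pi.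
  by apply: np; exists i.
split=> [[lp lphi]|].
  by apply: homology_cases pi lp _ => // v vC; rewrite lphi.
move=> cases; split=> [|v].
  case: cases => [l0|[a la]|[a [b lab]]].
  - by rewrite big1 ?addr0 ?oner_eq0 // => j _; rewrite l0 mul0r.
  - by have [] := scaling_invariant d0 (fun=> 0) la.
  - by have [] := swap_invariant (fun=> 0) lab.
case: cases => [l0|[a la]|[a [b lab]]].
- apply: eq_bigr => j _; rewrite /homology big1 ?mul0r ?addr0 // => k _.
  by rewrite l0 mul0r.
- by have [] := scaling_invariant d0 v la.
- by have [] := swap_invariant v lab.
Qed.

(** The group is thus counted by linear forms l, without reference to classes of rational maps. *)
Let groupE : (G #= [set l | preserving d p l]%classic)%card.
Proof.
have -> : G = ((fun l => ratmap_class C (homology_ratmap (p 0) l)) @`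
    [set l | preserving d p l])%classic.
  apply/seteqP; split=> tau.
    by move/(projection_group_homology d0 d4 char0 Pp p0) => [l pl ->]; exists l.
  by case=> l pl <-; apply: homology_in_projection_group.
apply: inj_card_eq => l l'; rewrite !inE /= => pl pl'.
exact: homology_ratmap_inj.
Qed.

Lemma card_group_coordinate : coordinate_vector (p 0) -> (G #= `I_d)%card.
Proof.
case=> a [pa pk]; apply: card_eq_trans groupE _.
have [|rs [urs srs rsE]] := exists_nth_roots d0 (c := 1); first by rewrite oner_eq0.
(* The form that makes 1 + l a * p a the k-th d-th root of unity; the root 1 gives the identity. *)
pose f (k : 'I_d) i := if i == a then (rs`_k - 1) / p 0 a else 0.
apply: (card_eq_finType (f := f)); last exact: card_ord.
  move=> k k' /(congr1 (fun h => h a)); rewrite /f eqxx => /(mulIf (invr_neq0 pa)).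
  by move/addIr/eqP; rewrite nth_uniq ?srs // => /eqP/val_inj.
have scal z : z ^+ d = 1 -> exists k, rs`_(k : 'I_d) = z.
  move=> zd; have zrs : z \in rs by rewrite rsE zd.
  have kd : (index z rs < d)%N by rewrite -srs index_mem.
  by exists (Ordinal kd); rewrite nth_index.
move=> l; split=> [/preservingP[l0|[b [pb pl lb]]|[b [c [bc _ lb lc _]]]]|[k <-]].
- have [k kE] := scal 1 (expr1n _ _); exists k; apply/funext => i.
  by rewrite /f kE subrr mul0r l0; case: ifP.
- have ab : b = a by apply/eqP/negP => /negP /pk pb0; case/eqP: pb.
  rewrite ab in pl lb; have [k kE] := scal _ lb; exists k; apply/funext => i.
  rewrite /f kE; case: eqVneq => [->|/pl[_ ->] //].
  by rewrite addrC addKr mulfK.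
- have nz x y : x * y = - 1 -> y != 0 :> K.
    by apply: contra_eq_neq => ->; rewrite mulr0 eq_sym oppr_eq0 oner_eq0.
  have ba : b = a by apply/eqP/negP => /negP /pk pb0; case/eqP: (nz _ _ lb).
  have ca : c = a by apply/eqP/negP => /negP /pk pc0; case/eqP: (nz _ _ lc).
  by case/eqP: bc; rewrite ba ca.
apply/preservingP; constructor 2; exists a; split=> // [j ja|].
  by rewrite /f (negPf ja) pk.
rewrite /f eqxx mulfVK // subrKC; apply/eqP; rewrite -rsE mem_nth // srs //.
Qed.

Lemma card_group_swap : swap_vector (p 0) -> (G #= `I_2)%card.
Proof.
case=> a [b [ab pa pab pk]]; apply: card_eq_trans groupE _.
have pb := swap_nz pa pab.
(* The conditions l a * p a = l b * p b = -1 leave no choice: one reflection besides the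
   identity. *)
pose li i := if (i == a) || (i == b) then - (p 0 i)^-1 else 0.
pose f (t : bool) := if t then li else fun=> 0.
apply: (card_eq_finType (f := f)); last exact: card_bool.
  have ga : li a != 0 by rewrite /li eqxx oppr_eq0 invr_eq0.
  by case=> [] [] // /(congr1 (fun h => h a)) /= E; case/eqP: ga.
have nz x y : x * y = - 1 -> y != 0 :> K.
  by apply: contra_eq_neq => ->; rewrite mulr0 eq_sym oppr_eq0 oner_eq0.
have supp i : p 0 i != 0 -> (i == a) || (i == b).
  by apply: contraNT; rewrite negb_or => /andP[ia ib]; rewrite pk.
move=> l; split=> [/preservingP[l0|[e [pe pl _]]|[e [e' [ee' _ le le' lk]]]]|[t <-]].
- by exists false; apply/funext => i; rewrite l0.
- have ae : a = e by apply/eqP/negP => /negP /pl[pa0 _]; case/eqP: pa.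
  have be : b = e by apply/eqP/negP => /negP /pl[pb0 _]; case/eqP: pb.
  by case/eqP: ab; rewrite ae be.
- exists true; apply/funext => i; rewrite /= /li.
  have inv j : l j * p 0 j = - 1 -> - (p 0 j)^-1 = l j.
    by move=> lj; apply: (mulIf (nz _ _ lj)); rewrite lj mulNr mulVf // (nz _ _ lj).
  have [->|ie] := eqVneq i e; first by rewrite supp ?(nz _ _ le) // inv.
  have [->|ie'] := eqVneq i e'; first by rewrite supp ?(nz _ _ le') // inv.
  have [pi0 ->] := lk i ie ie'; case: ifP => // /orP[] /eqP ii.
    by case/eqP: pa; rewrite -ii.
  by case/eqP: pb; rewrite -ii.
apply/preservingP; case: t => /=; last by constructor 1.
constructor 3; exists a, b; split=> //.
- by rewrite /li eqxx mulNr mulVf.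
- by rewrite /li eqxx orbT mulNr mulVf.
- by move=> k ka kb; rewrite /li (negPf ka) (negPf kb) pk.
Qed.

Lemma quasi_Galois_vector : quasi_Galois C P ->
  coordinate_vector (p 0) \/ swap_vector (p 0).
Proof.
rewrite /quasi_Galois (card_le_eqr groupE) => le2; apply: contrapT => /not_orP[nA nB].
have l0 l : preserving d p l -> l = fun=> 0.
  case/preservingP => [l0|[a [pa pl _]]|[a [b [ab pab la lb lk]]]].
  - exact/funext.
  - by case: nA; exists a; split=> // k /pl[].
  - case: nB; exists a, b; split=> //; last by move=> k ka kb; case: (lk k ka kb).
    by move: la; apply: contra_eq_neq => ->; rewrite mulr0 eq_sym oppr_eq0 oner_eq0.
have sub : ([set l | preserving d p l] `<=` [set (fun=> 0 : K)])%classic by move=> l /l0.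
have := card_le_trans le2 (subset_card_le sub).
by rewrite (card_le_eqr card_set1) card_le_II.
Qed.

End Group.

End GroupOrders.

(** * Counting quasi-Galois points *)

Section Counting.
Variables (K : closedFieldType) (d : nat).
Hypothesis d0 : d%:R != 0 :> K.
Hypothesis d4 : (4 <= d)%N.
Hypothesis char0 : forall n : nat, (n%:R == 0 :> K) = (n == 0)%N.
Implicit Types (f g : {mpoly K[3]}) (v : 'I_3 -> K).
Local Notation phi := (phi d).
Local Notation van := (van d).
Local Notation Phi := (Phi K d).
Local Notation C := (fermat_curve K d).

Let dp : (0 < d)%N. Proof. by case: (d) d0; rewrite ?eqxx. Qed.

Lemma card_count (T : choiceType) (A : set T) n :
  (A #= `I_n)%card -> Defs.card A = (n : nat)%:E.
Proof.
move=> An; rewrite /Defs.card; case: pselect => [finA|[]].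
  by rewrite (card_fset_set An).
by apply/finite_setP; exists n.
Qed.

Lemma vlineZ (k : K) (v : 'rV[K]_3) : k != 0 -> <[k *: v]>%VS = <[v]>%VS.
Proof.
move=> k0; apply/eqP; rewrite eqEsubv -!memvE; apply/andP; split; first by rewrite memvZ ?memv_line.
by apply/vlineP; exists k^-1; rewrite scalerA mulVf // scale1r.
Qed.

Definition coordinate_point (P : proj_space K 2) :=
  exists2 p : 'rV[K]_3, line P = <[p]>%VS & coordinate_vector (p 0).

Definition swap_point (P : proj_space K 2) :=
  exists2 p : 'rV[K]_3, line P = <[p]>%VS & swap_vector d (p 0).

Let vector_neq0 (p : 'rV[K]_3) a : p 0 a != 0 -> p != 0.
Proof. by apply: contra_neq => ->; rewrite mxE. Qed.

Let coordinate_neq0 (p : 'rV[K]_3) : coordinate_vector (p 0) -> p != 0.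
Proof. by case=> a [/vector_neq0]. Qed.

Let swap_neq0 (p : 'rV[K]_3) : swap_vector d (p 0) -> p != 0.
Proof. by case=> a [b [_ /vector_neq0]]. Qed.

Lemma coordinate_pointP P : coordinate_point P ->
  [/\ ~ C P, quasi_Galois C P & (projection_group C P #= `I_d)%card].
Proof.
case=> p Pp pc; have GP := card_group_coordinate d0 d4 char0 Pp (coordinate_neq0 pc) pc.
split=> //.
  rewrite (fermat_curveE d Pp); case: pc => a [pa pk]; apply/eqP.
  rewrite /phi (bigD1 a) //= big1 ?addr0 ?expf_neq0 // => k /pk ->.
  by rewrite expr0n (gtn_eqF dp).
by rewrite /quasi_Galois (card_le_eqr GP) card_le_II (leq_trans _ d4).
Qed.

(** At such a point phi is p b ^+ d times (-1)^d + 1, which is why the parity of d decides whether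
    the point lies on C. *)
Lemma swap_pointP P : swap_point P ->
  [/\ C P <-> odd d, quasi_Galois C P & (projection_group C P #= `I_2)%card].
Proof.
case=> p Pp ps; have GP := card_group_swap d0 d4 char0 Pp (swap_neq0 ps) ps.
split=> //; last by rewrite /quasi_Galois (card_le_eqr GP) card_le_II.
rewrite (fermat_curveE d Pp); case: ps => a [b [ab pa pab pk]].
have [c [ca cb sumE]] := third_index ab.
rewrite /phi sumE (pk c) // pab expr0n (gtn_eqF dp) addr0 exprNn -signr_odd.
case: (odd d); first by rewrite expr1 mulN1r addNr.
rewrite expr0 mul1r -mulr2n -mulr_natl; split=> // /eqP.
rewrite mulf_eq0 char0 /= => /eqP pb; case/eqP: pa.
by move/eqP: pab; rewrite exprNn pb mulr0 expf_eq0 => /andP[_ /eqP].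
Qed.

Lemma quasi_Galois_cases P : quasi_Galois C P -> coordinate_point P \/ swap_point P.
Proof.
move=> qP; have [p Pp p0] := line_generator P.
by have [] := quasi_Galois_vector d0 d4 char0 Pp p0 qP; [left|right]; exists p.
Qed.

Let choose_points (T : Type) (v : T -> 'rV[K]_3) : (forall t, v t != 0) ->
  exists f : T -> proj_space K 2, forall t, line (f t) = <[v t]>%VS.
Proof.
move=> v0; have [f fE] := @boolp.choice T (proj_space K 2)
  (fun t P => line P = <[v t]>%VS) (fun t => proj_point_ex (v0 t)).
by exists f.
Qed.

Let unit_row (a : 'I_3) : 'rV[K]_3 := \row_i (i == a)%:R.

Lemma coordinate_points_enum : exists f : 'I_3 -> proj_space K 2,
  injective f /\ forall P, coordinate_point P <-> exists a, f a = P.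
Proof.
have [|f fE] := @choose_points _ unit_row.
  by move=> a; apply: (vector_neq0 (a := a)); rewrite mxE eqxx oner_eq0.
exists f; split=> [a b /(congr1 (@line K 2))|P].
  rewrite !fE => ab; have := memv_line (unit_row a); rewrite ab => /vlineP[k /rowP/(_ a)].
  rewrite !mxE eqxx; case: eqVneq => // _ /eqP.
  by rewrite mulr0 oner_eq0.
split=> [[p Pp [a [pa pk]]]|[a <-]].
  exists a; apply: line_inj; rewrite fE Pp -(vlineZ _ pa); congr (<[_]>%VS).
  apply/rowP => i; rewrite !mxE.
  by have [->|/pk ->] := eqVneq i a; rewrite ?mulr1 ?mulr0.
exists (unit_row a) => //; exists a; rewrite mxE eqxx oner_eq0; split=> // k /negPf ka.
by rewrite mxE ka.
Qed.

Let next_neq (a : 'I_3) : a + 1 != a.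
Proof. by move: a; apply: ord3P. Qed.

Lemma swap_points_enum : exists f : 'I_3 * 'I_d -> proj_space K 2,
  injective f /\ forall P, swap_point P <-> exists t, f t = P.
Proof.
have c0 : (-1) ^+ d != 0 :> K by rewrite signr_eq0.
have [rs [urs srs rsE]] := exists_nth_roots d0 c0.
have rsd (k : 'I_d) : rs`_k ^+ d = (-1) ^+ d.
  by apply/eqP; rewrite -rsE mem_nth // srs.
have rs0 (k : 'I_d) : rs`_k != 0.
  by have := rsd k; apply: contra_eq_neq => ->; rewrite expr0n (gtn_eqF dp) eq_sym.
(* Each pair of distinct indices is (a, a + 1) modulo 3 for exactly one a. With the coordinate at a
   normalized to 1, the other one is one of the d roots of z^d = (-1)^d. *)
pose w (t : 'I_3 * 'I_d) : 'rV[K]_3 :=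
  \row_i (if i == t.1 then 1 else if i == t.1 + 1 then rs`_t.2 else 0).
have w0 t : w t 0 t.1 = 1 by rewrite mxE eqxx.
have w1 t : w t 0 (t.1 + 1) = rs`_t.2 by rewrite mxE (negPf (next_neq _)) eqxx.
have w2 t i : i != t.1 -> i != t.1 + 1 -> w t 0 i = 0.
  by move=> /negPf i1 /negPf i2; rewrite mxE i1 i2.
have [|f fE] := @choose_points _ w.
  by move=> t; apply: (vector_neq0 (a := t.1)); rewrite w0 oner_eq0.
exists f; split=> [t t' /(congr1 (@line K 2))|P].
  rewrite !fE => tt'; have := memv_line (w t); rewrite tt' => /vlineP[c /rowP wc].
  have wcE i : w t 0 i = c * w t' 0 i by rewrite wc mxE.
  have c1 : c != 0 by have := wcE t.1; rewrite w0; apply: contra_eq_neq => ->;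
    rewrite mul0r oner_eq0.
  have z i : (w t 0 i == 0) = (w t' 0 i == 0) by rewrite wcE mulf_eq0 (negPf c1).
  (* The position of the only zero coordinate determines the pair of indices. *)
  have t1 : t.1 = t'.1.
    have := z t.1; have := z (t.1 + 1); rewrite w0 w1 oner_eq0 (negPf (rs0 _)) !mxE.
    by move: (t.1) (t'.1) (rs0 t'.2); apply: ord3P; apply: ord3P; rewrite //= eqxx.
  have := wcE t.1; rewrite w0 t1 w0 mulr1 => c1'.
  have := wcE (t.1 + 1); rewrite w1 t1 w1 -c1' mul1r => /eqP.
  rewrite nth_uniq ?srs // => /eqP/val_inj.
  by move: t1; case: (t) (t') => [? ?] [? ?] /= -> ->.
split=> [[p Pp ps]|[t <-]]; last first.
  exists (w t) => //; exists t.1, (t.1 + 1); rewrite w0 w1 oner_eq0 eq_sym next_neq.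
  split=> // [|k k1 k2]; last by rewrite w2.
  by rewrite exprNn rsd -exprMn mulrNN mulr1.
have {ps} [a [pa pab pk]] : exists a, [/\ p 0 a != 0, p 0 a ^+ d = (- p 0 (a + 1)) ^+ d &
    forall k, k != a -> k != a + 1 -> p 0 k = 0].
  case: ps => a [b [ab pa pab pk]]; have [ba|ba] := eqVneq b (a + 1).
    by exists a; rewrite -ba.
  have ab1 : a = b + 1.
    by apply/eqP; move: a b ab ba {pa pab pk}; apply: ord3P; apply: ord3P.
  exists b; rewrite -ab1; split.
  - by apply: contra_neq pa => pb; apply/eqP; move/eqP: pab;
      rewrite pb oppr0 expr0n (gtn_eqF dp) expf_eq0 => /andP[].
  - by rewrite [RHS]exprNn pab -exprMn mulN1r opprK.
  - by move=> k kb ka; apply: pk.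
have zd : (p 0 (a + 1) / p 0 a) ^+ d = (-1) ^+ d.
  have pad : p 0 a ^+ d != 0 by rewrite expf_neq0.
  by apply: (mulIf pad); rewrite -exprMn mulfVK // pab -exprMn mulN1r opprK.
have zrs : p 0 (a + 1) / p 0 a \in rs by rewrite rsE zd.
have kd : (index (p 0 (a + 1) / p 0 a)%R rs < d)%N by rewrite -srs index_mem.
exists (a, Ordinal kd); apply: line_inj; rewrite fE Pp -(vlineZ _ pa); congr (<[_]>%VS).
apply/rowP => i; rewrite !mxE /=.
have [->|ia] := eqVneq i a; first by rewrite mulr1.
have [->|ia1] := eqVneq i (a + 1); first by rewrite nth_index // mulrCA divff ?mulr1.
by rewrite mulr0 pk.
Qed.

Lemma card_coordinate_points : ([set P | coordinate_point P]%classic #= `I_3)%card.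
Proof.
have [f [finj fE]] := coordinate_points_enum.
exact: card_eq_finType finj fE (card_ord 3).
Qed.

Lemma card_swap_points : ([set P | swap_point P]%classic #= `I_(3 * d))%card.
Proof.
have [f [finj fE]] := swap_points_enum.
by apply: card_eq_finType finj fE _; rewrite card_prod !card_ord.
Qed.

(** The group orders d and 2 differ. *)
Lemma coordinate_not_swap P : coordinate_point P -> ~ swap_point P.
Proof.
move=> /coordinate_pointP[_ _ Gd] /swap_pointP[_ _]; rewrite (card_eql Gd).
by move/card_eq_II => d2; move: d4; rewrite d2.
Qed.

Lemma card_quasi_Galois_points :
  ([set P | coordinate_point P \/ swap_point P]%classic #= `I_(3 + 3 * d))%card.
Proof.
have [f [finj fE]] := coordinate_points_enum; have [g [ginj gE]] := swap_points_enum.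
pose h (t : 'I_3 + 'I_3 * 'I_d) := match t with inl a => f a | inr a => g a end.
apply: (card_eq_finType (f := h)).
- have fg a b : f a <> g b.
    move=> ab; have /coordinate_not_swap : coordinate_point (f a) by apply/fE; exists a.
    by apply; apply/gE; exists b.
  case=> [a|a] [b|b] /=; first by move/finj ->.
  + by move/fg.
  + by move/esym/fg.
  + by move/ginj ->.
- move=> P; split=> [[/fE[a]|/gE[a]]|[[a|a] <-]].
  + by exists (inl a).
  + by exists (inr a).
  + by left; apply/fE; exists a.
  + by right; apply/gE; exists a.
by rewrite card_sum card_prod !card_ord.
Qed.

Lemma delta'_eq_d : delta'_eq C d = 3%N%:E.
Proof.
apply: card_count; rewrite (_ : [set _ | _]%classic = [set P | coordinate_point P]%classic).
  exact: card_coordinate_points.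
apply/seteqP; split=> P /=; last exact: coordinate_pointP.
case=> _ qP Gd; have [//|/swap_pointP[_ _]] := quasi_Galois_cases qP.
by rewrite (card_eql Gd) => /card_eq_II d2; move: d4; rewrite d2.
Qed.

Section Even.
Hypothesis deven : ~~ odd d.

Lemma delta'_ge_2_even : delta'_ge C 2 = (3 + 3 * d)%N%:E.
Proof.
apply: card_count.
rewrite (_ : [set _ | _]%classic = [set P | coordinate_point P \/ swap_point P]%classic).
  exact: card_quasi_Galois_points.
apply/seteqP; split=> P /=; first by case=> _ /quasi_Galois_cases.
case=> [/coordinate_pointP[] //|/swap_pointP[CP qP _]].
by split=> // /CP; apply/negP.
Qed.

Lemma delta'_eq_2_even : delta'_eq C 2 = (3 * d)%N%:E.
Proof.
apply: card_count; rewrite (_ : [set _ | _]%classic = [set P | swap_point P]%classic).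
  exact: card_swap_points.
apply/seteqP; split=> P /=.
  case=> _ qP G2; have [/coordinate_pointP[_ _]|//] := quasi_Galois_cases qP.
  by rewrite (card_eql G2) => /card_eq_II d2; move: d4; rewrite -d2.
case/swap_pointP => CP qP G2.
by split=> // /CP; apply/negP.
Qed.

Lemma delta_ge_2_even : delta_ge C 2 = 0%N%:E.
Proof.
apply: card_count; rewrite (_ : [set _ | _]%classic = set0) ?II0 //.
apply/seteqP; split=> P //= [CP /quasi_Galois_cases[/coordinate_pointP[]//|]].
by case/swap_pointP => /proj1/(_ CP); rewrite (negPf deven).
Qed.
End Even.

Section Odd.
Hypothesis dodd : odd d.

Lemma delta'_ge_2_odd : delta'_ge C 2 = delta'_eq C d.
Proof.
congr Defs.card; apply/seteqP; split=> P /= [nC qP _].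
  have [/coordinate_pointP[] //|/swap_pointP[CP _ _]] := quasi_Galois_cases qP.
  by case: nC; apply/CP.
by [].
Qed.

Lemma delta_eq_2_odd : delta_eq C 2 = (3 * d)%N%:E.
Proof.
apply: card_count; rewrite (_ : [set _ | _]%classic = [set P | swap_point P]%classic).
  exact: card_swap_points.
apply/seteqP; split=> P /=.
  by case=> CP /quasi_Galois_cases[/coordinate_pointP[]|].
by case/swap_pointP => CP qP G2; split=> //; apply/CP.
Qed.

Lemma delta_ge_2_odd : delta_ge C 2 = delta_eq C 2.
Proof.
congr Defs.card; apply/seteqP; split=> P /= [CP qP _]; last by [].
have [/coordinate_pointP[] //|/swap_pointP[]] := quasi_Galois_cases qP.
by split.
Qed.
End Odd.

End Counting.

Theorem theorem5p3 (K : closedFieldType) (d : nat) :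
  [pchar K] =i pred0 -> (4 <= d)%N ->
  let C := fermat_curve K d in
  [/\ delta'_eq C d = 3%N%:E,
      ~~ odd d ->
        [/\ delta'_ge C 2 = (delta'_eq C d + delta'_eq C 2)%E,
            delta'_ge C 2 = (3 + 3 * d)%N%:E &
            delta_ge C 2 = 0%N%:E] &
      odd d ->
        [/\ delta'_ge C 2 = delta'_eq C d,
            delta'_eq C d = 3%N%:E,
            delta_ge C 2 = delta_eq C 2 &
            delta_eq C 2 = (3 * d)%N%:E]].
Proof.
move=> /pcharf0P char0 d4 C.
have d0 : d%:R != 0 :> K by rewrite char0 -lt0n (leq_trans _ d4).
have delta'_d := delta'_eq_d d0 d4 char0.
split=> // parity; split=> //.
- by rewrite delta'_d (delta'_eq_2_even d0) ?(delta'_ge_2_even d0).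
- exact: delta'_ge_2_even.
- exact: delta_ge_2_even.
- exact: delta'_ge_2_odd.
- exact: delta_ge_2_odd.
- exact: delta_eq_2_odd.
Qed.
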